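(* Let $\mu$ be a probability measure on $\mathbb{R}^d$ with support $D$, and let $\{V_n\}_{n=0}^\infty\subset L^2_\mu(D)$ be a hierarchical sequence of finite-dimensional subspaces with $N_n=\dim V_n$, $q^*<\infty$ and $1\in V_0$. For each $n$ let $\mathcal{A}_n=\{X_m\}_{m=1}^{M_n}$ with $X_m$ i.i.d. with distribution $\mu_{V_n}$, where $M_n=25N_n\log N_n$. If in addition $\{V_n\}_{n=0}^\infty$ is a $\mu$ZC sequence, then with probability $1$, $\{\mathcal{A}_n\}_{n=0}^\infty$ is a (classical) WAM for $\{V_n\}_{n=0}^\infty$ with exponents $a=1+\tau$ and $b=\frac{q^*+1}{2}+\tau$, for any $\tau>0$.
   Context: Functions are complex-valued and defined pointwise on $D=\operatorname{supp}\mu$. Hierarchical means $V_n\subset V_{n+1}$ and $\dim V_n<\dim V_{n+1}$, with $N_n\ge1$. For an $N$-dimensional $V\subset L^2_\mu(D)$ with $L^2_\mu$-orthonormal basis $v_1,\dots,v_N$, $K(x,x)=\sum_{i=1}^N|v_i(x)|^2$ and $K_\mu(V)=\sup_{x\in D}K(x,x)$ (independent of the basis); $K_\mu(V_n)<\infty$ is assumed for all $n$. The $V$-induced measure is the probability measure $d\mu_V(x)=\frac1NK(x,x)\,d\mu(x)$. $q^*=\limsup_{n\to\infty}\frac{\log K_\mu(V_n)}{\log N_n}$. $\{V_n\}$ is a $\mu$ZC sequence if for all $n$, $\mu(\{x\in D: v(x)=0\})=0$ for every $v\in V_n\setminus\{0\}$. A sequence of finite sets $\mathcal{A}_n\subset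 D$ is a (classical) weakly admissible mesh (WAM) for $\{V_n\}$ with exponents $(a,b)$ if there are finite constants $k_a,k_b$ such that for all $n\ge0$: $\sup_{x\in D}|v(x)|\le k_bN_n^b\max_{x\in\mathcal{A}_n}|v(x)|$ for all $v\in V_n$, and $|\mathcal{A}_n|\le k_aN_n^a$. (Here $k_a$, $k_b$ may depend on $\tau$ and on the realization of the samples.)
   Formalization: The sample size is M_n = max(1, ⌈25 N_n log N_n⌉): 25 N_n log N_n is not an integer for N_n ≥ 2, and for N_0 = 1 (e.g. V_0 the constants) it is 0, so the mesh would be empty and the bound would fail for the function 1. *)

(* Defs.v *)
From HB Require Import structures.
From mathcomp Require Import all_boot all_order all_algebra.
From mathcomp Require Import all_classical all_reals all_analysis.
From mathcomp Require Import finmap.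
From mathcomp.real_closed Require Import complex.

Set Implicit Arguments.
Unset Strict Implicit.
Unset Printing Implicit Defensive.

Import Order.TTheory GRing.Theory Num.Theory.
Import numFieldNormedType.Exports.

Local Open Scope classical_set_scope.
Local Open Scope ring_scope.
Local Open Scope complex_scope.

(* R^d with its Borel sigma-algebra. *)
Definition borelRn (R : realType) (d : nat) :=
  g_sigma_algebraType (@open 'rV[R]_d).

Definition cabs (R : realType) (z : R[i]) : R := ComplexField.Normc.normc z.

Section spaces.
Context {R : realType} {d : nat}.
Local Notation E := (borelRn R d).
Implicit Types (mu : probability E R) (V : set (E -> R[i])).

(* Every neighbourhood in the topology of R^d contains an open, hence
   measurable, one; only open sets are measured. *)
Definition supp mu : set E :=
  [set x | forall U : set 'rV[R]_d, open U -> U x -> (0 < mu U)%E].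

(* A complex function on D = supp mu is encoded as its extension by 0 to R^d,
   so that equality of functions on D is Leibniz equality. The functions are
   defined pointwise: no quotient by mu-a.e. equality is taken. *)
Definition fun_on (D : set E) (f : E -> R[i]) : Prop :=
  forall x, ~ D x -> f x = 0.

Definition L2 mu (f : E -> R[i]) : Prop :=
  [/\ fun_on (supp mu) f,
      measurable_fun (supp mu) (fun x => complex.Re (f x)),
      measurable_fun (supp mu) (fun x => complex.Im (f x)) &
      (\int[mu]_(x in supp mu) (cabs (f x) ^+ 2)%:E < +oo)%E].

Definition inner mu (f g : E -> R[i]) : R[i] :=
  (\int[mu]_(x in supp mu) complex.Re (f x * conjc (g x))) +i*
  (\int[mu]_(x in supp mu) complex.Im (f x * conjc (g x))).

Definition span_of (N : nat) (v : 'I_N -> E -> R[i]) : set (E -> R[i]) :=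
  [set f | exists c : 'I_N -> R[i], f = \sum_(i < N) c i *: v i].

(* v is an L^2_mu-orthonormal basis of the subspace V of L^2_mu(D); in
   particular V is a linear subspace of dimension N. *)
Definition orthonormal_basis mu V (N : nat) (v : 'I_N -> E -> R[i]) : Prop :=
  [/\ V `<=` L2 mu,
      V = span_of v &
      forall i j, inner mu (v i) (v j) = (i == j)%:R].

(* K(x, x) *)
Definition Kdiag (N : nat) (v : 'I_N -> E -> R[i]) (x : E) : R :=
  \sum_(i < N) cabs (v i x) ^+ 2.

Definition Ksup mu (N : nat) (v : 'I_N -> E -> R[i]) : \bar R :=
  ereal_sup [set (Kdiag v x)%:E | x in supp mu].

Definition induced_measure mu (N : nat) (v : 'I_N -> E -> R[i])
    (A : set E) : \bar R :=
  ((N%:R^-1)%:E * \int[mu]_(x in A) (Kdiag v x)%:E)%E.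

Definition qstar mu (N : nat -> nat) (v : forall n, 'I_(N n) -> E -> R[i]) :
    \bar R :=
  limn_esup (fun n => (ln (fine (Ksup mu (v n))) / ln (N n)%:R)%:E).

Definition muZC mu (V : nat -> set (E -> R[i])) : Prop :=
  forall n (f : E -> R[i]), V n f -> f <> 0 ->
    mu (supp mu `&` [set x | f x = 0]) = 0%E.

(* N n is the dimension of V n. The inner maximum is over a finite set of
   nonnegative reals (and is 0 over the empty set). *)
Definition WAM (D : set E) (V : nat -> set (E -> R[i])) (N : nat -> nat)
    (a b : R) (A : nat -> set E) : Prop :=
  (forall n, finite_set (A n) /\ A n `<=` D) /\
  exists ka kb : R, forall n,
    (forall f, V n f ->
      (ereal_sup [set (cabs (f x))%:E | x in D] <=
       (kb * (N n)%:R `^ b *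
        \big[Num.max/0]_(x <- fset_set (A n)) cabs (f x))%:E)%E) /\
    (#|` fset_set (A n)|%fset)%:R <= ka * (N n)%:R `^ a.

End spaces.

Definition mutually_independent {d1 d2 : measure_display}
    {Omega : measurableType d1} {T : measurableType d2} {R : realType}
    (P : probability Omega R) (m : nat) (X : 'I_m -> Omega -> T) : Prop :=
  forall (J : {set 'I_m}) (B : 'I_m -> set T), (forall i, measurable (B i)) ->
    P (\bigcap_(i in [set` J]) (X i @^-1` B i)) =
    (\prod_(i in J) P (X i @^-1` B i))%E.

(* 25 N log N rounded up to an integer. At least one point is drawn, which only
   matters for N = 1, where log N = 0 and a maximum over no point would be
   meaningless. *)
Definition mesh_size (R : realType) (N : nat) : nat :=
  maxn 1 `|Num.ceil (25%:R * N%:R * ln (N%:R : R))|%N.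

(* Main.v *)
Require Import Defs.
From HB Require Import structures.
From mathcomp Require Import all_boot all_order all_algebra.
From mathcomp Require Import all_classical all_reals all_analysis.
From mathcomp.real_closed Require Import complex.
From mathcomp Require Import measurable_realfun ring lra.

Set Implicit Arguments.
Unset Strict Implicit.
Unset Printing Implicit Defensive.

Import Order.TTheory GRing.Theory Num.Theory.
Import numFieldNormedType.Exports.

Local Open Scope classical_set_scope.
Local Open Scope ring_scope.
Local Open Scope complex_scope.

(* Expand functions of V_n in the orthonormal basis and let u_m be the
   normalized vector v(X_m) / sqrt K(X_m); for the induced measure it is an
   isotropic random unit vector of C^N. If Pi is the product of the M
   orthogonal projections onto the complements of u_1, ..., u_M, then the mean
   squared norm of Pi c is (1 - 1/N)^M |c|^2, so that M = 25 N log N makes the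
   Frobenius norm of Pi at most 1/2 except with probability O(N^-24), which is
   summable in n since N_n > n. Conversely, if <c, u_m> is small for all m, the
   projections hardly move c; hence a product Pi of norm at most 1/2 forces
   |c|^2 <= 4 sum_m |<c, u_m>|^2. Since 1 is in V_n, K >= 1, and so
   sup |f|^2 <= 4 M K_mu(V_n) max_m |f(X_m)|^2 for all large n. By independence
   and the muZC property, Gaussian elimination almost surely meets no zero
   pivot on the first N samples, so for each of the remaining n a function of
   V_n vanishing on the mesh is 0, which gives some finite constant. *)

Local Notation Re := complex.Re.
Local Notation Im := complex.Im.

(** * Products of projections and elimination *)

Section squared_modulus.
Context {R : realType}.
Implicit Types (x y z : R[i]) (r : R).

(** A polynomial in the real and imaginary parts: identities reduce to [ring], and measurability
    involves no square root. *)
Definition sqn z : R := Re z ^+ 2 + Im z ^+ 2.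

Lemma cabs_sqr z : cabs z ^+ 2 = sqn z.
Proof. by case: z => a b; rewrite /cabs /= sqr_sqrtr ?addr_ge0 ?sqr_ge0. Qed.

Lemma cabs_ge0 z : 0 <= cabs z.
Proof. by case: z => a b; rewrite /cabs /= sqrtr_ge0. Qed.

Lemma sqn_ge0 z : 0 <= sqn z.
Proof. by rewrite addr_ge0 ?sqr_ge0. Qed.

Lemma sqn_eq0 z : (sqn z == 0) = (z == 0).
Proof.
by case: z => a b; rewrite paddr_eq0 ?sqr_ge0 ?sqrf_eq0// eq_complex.
Qed.

Lemma sqn0 : sqn 0 = 0.
Proof. by apply/eqP; rewrite sqn_eq0. Qed.

Lemma ReD x y : Re (x + y) = Re x + Re y.
Proof. by case: x y => [a b] [c d]. Qed.

Lemma ImD x y : Im (x + y) = Im x + Im y.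
Proof. by case: x y => [a b] [c d]. Qed.

Lemma ReM x y : Re (x * y) = Re x * Re y - Im x * Im y.
Proof. by case: x y => [a b] [c d]. Qed.

Lemma ImM x y : Im (x * y) = Re x * Im y + Im x * Re y.
Proof. by case: x y => [a b] [c d]. Qed.

Lemma ReN x : Re (- x) = - Re x.
Proof. by case: x. Qed.

Lemma ImN x : Im (- x) = - Im x.
Proof. by case: x. Qed.

Lemma Re_conjc x : Re (conjc x) = Re x.
Proof. by case: x. Qed.

Lemma Im_conjc x : Im (conjc x) = - Im x.
Proof. by case: x. Qed.

Definition ReImE := (ReD, ImD, ReN, ImN, ReM, ImM, Re_conjc, Im_conjc).

Lemma Re_sum I (s : seq I) (F : I -> R[i]) :
  Re (\sum_(i <- s) F i) = \sum_(i <- s) Re (F i).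
Proof. by elim/big_rec2 : _ => //= i x y _ <-; rewrite ReD. Qed.

Lemma Im_sum I (s : seq I) (F : I -> R[i]) :
  Im (\sum_(i <- s) F i) = \sum_(i <- s) Im (F i).
Proof. by elim/big_rec2 : _ => //= i x y _ <-; rewrite ImD. Qed.

Lemma sqnM x y : sqn (x * y) = sqn x * sqn y.
Proof. by rewrite /sqn !ReImE; ring. Qed.

Lemma sqn_real r : sqn r%:C = r ^+ 2.
Proof. by rewrite /sqn /=; ring. Qed.

Lemma sqn_conjc x : sqn (conjc x) = sqn x.
Proof. by rewrite /sqn !ReImE sqrrN. Qed.

Lemma sqnB x y : sqn (x - y) = sqn x + sqn y - 2 * Re (x * conjc y).
Proof. by rewrite /sqn !ReImE; ring. Qed.

(* AM-GM with the weights 1 and 1/4. *)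
Lemma Re_mul_conjc_le x y : Re (x * conjc y) <= sqn x + sqn y / 4.
Proof.
rewrite -subr_ge0 (_ : _ - _ = sqn (x - y * (2^-1)%:C)) ?sqn_ge0//.
by rewrite /sqn !ReImE /=; field.
Qed.

End squared_modulus.

(** * Orthogonal projections onto hyperplanes and Gaussian elimination *)

Section kaczmarz.
Context {R : realType} {N : nat}.
Implicit Types (c s w : 'I_N -> R[i]).

Definition nsq c : R := \sum_i sqn (c i).

(** No conjugation: for [w = v^~ x] this is the value at [x] of the function with coefficients [c].
    The normal vector of its kernel is therefore the conjugate of [w]. *)
Definition ev c w : R[i] := \sum_i c i * w i.

(* Orthogonal projection of c onto the hyperplane [ev _ w = 0]; it is the
   identity for w = 0, where the inverse is 0. *)
Definition kstep c w : 'I_N -> R[i] :=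
  fun i => c i - ev c w * ((nsq w)^-1)%:C * conjc (w i).

Lemma nsq_ge0 c : 0 <= nsq c.
Proof. by apply: sumr_ge0 => i _; exact: sqn_ge0. Qed.

Lemma nsq_eq0 c : nsq c = 0 -> forall i, c i = 0.
Proof.
move=> /eqP; rewrite psumr_eq0 => [/allP c0 i|i _]; last exact: sqn_ge0.
by have := c0 i (mem_index_enum i); rewrite sqn_eq0 => /eqP.
Qed.

Lemma ev0r c w : nsq w = 0 -> ev c w = 0.
Proof. by move=> /nsq_eq0 w0; apply: big1 => i _; rewrite w0 mulr0. Qed.

(** The removed component is a multiple of the conjugate of [w], so pairing it with [c] only sees
    [ev c w]. *)
Lemma Re_dot_kstep c s w :
  \sum_i Re (c i * conjc (s i - kstep s w i)) =
  Re (ev c w * conjc (ev s w)) / nsq w.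
Proof.
transitivity (Re ((ev c w * conjc (ev s w)) * ((nsq w)^-1)%:C)); last first.
  by rewrite ReM /= mulr0 subr0.
rewrite {1}/ev !mulr_suml Re_sum; apply: eq_bigr => i _.
by rewrite /kstep !ReImE /=; ring.
Qed.

(** Pythagoras' theorem, by expanding the square of [c] minus the removed component. For [w = 0] the
    quotient is 0 and nothing is removed. *)
Lemma nsq_kstep c w : nsq (kstep c w) = nsq c - sqn (ev c w) / nsq w.
Proof.
have E i : sqn (kstep c w i) = sqn (c i) + sqn (c i - kstep c w i)
    - 2 * Re (c i * conjc (c i - kstep c w i)).
  by rewrite -sqnB; congr sqn; ring.
rewrite /nsq (eq_bigr _ (fun i _ => E i)) sumrB big_split/= -mulr_sumr.
rewrite Re_dot_kstep -addrA; congr (_ + _).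
have -> : \sum_i sqn (c i - kstep c w i) = sqn (ev c w) / nsq w.
  transitivity (\sum_i sqn (ev c w) * (nsq w)^-1 ^+ 2 * sqn (w i)).
    apply: eq_bigr => i _; rewrite -sqn_real -(sqn_conjc (w i)) -!sqnM.
    by congr sqn; rewrite /kstep; ring.
  rewrite -mulr_sumr -/(nsq w) expr2 -!mulrA.
  have [->|w0] := eqVneq (nsq w) 0; first by rewrite invr0 !(mulr0, mul0r).
  by rewrite mulVf// mulr1.
have -> : Re (ev c w * conjc (ev c w)) = sqn (ev c w).
  by rewrite /sqn !ReImE; ring.
by rewrite /nsq; ring.
Qed.

(** The Cauchy-Schwarz inequality, as nonnegativity of the squared norm left after projecting. *)
Lemma sqn_ev_div_le c w : sqn (ev c w) / nsq w <= nsq c.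
Proof. by rewrite -subr_ge0 -nsq_kstep nsq_ge0. Qed.

Lemma sqn_ev_le c w : sqn (ev c w) <= nsq c * nsq w.
Proof.
have [w0|w0] := eqVneq (nsq w) 0; first by rewrite ev0r// sqn0 w0 mulr0.
by rewrite -ler_pdivrMr ?sqn_ev_div_le// lt_neqAle eq_sym w0 nsq_ge0.
Qed.

Section trajectory.
Variable w : nat -> 'I_N -> R[i].

Fixpoint traj c k := if k is k'.+1 then kstep (traj c k') (w k') else c.

Definition unitvec (j : 'I_N) : 'I_N -> R[i] := fun i => (i == j)%:R.

Lemma nsq_unitvec j : nsq (unitvec j) = 1.
Proof.
rewrite /nsq (bigD1 j)//= /unitvec eqxx big1 ?addr0.
  by rewrite /sqn /=; ring.
by move=> i /negPf ->; rewrite sqn0.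
Qed.

Lemma nsq_traj c k :
  nsq (traj c k) + \sum_(l < k) sqn (ev (traj c l) (w l)) / nsq (w l) = nsq c.
Proof.
elim: k => [|k IH]; first by rewrite big_ord0 addr0.
by rewrite big_ord_recr/= nsq_kstep -[RHS]IH; ring.
Qed.

Lemma traj_linear c k i : traj c k i = \sum_j c j * traj (unitvec j) k i.
Proof.
elim: k i => [|k IH] i /=.
  rewrite (bigD1 i)//= /unitvec eqxx mulr1 big1 ?addr0// => j.
  by rewrite eq_sym => /negPf ->; rewrite mulr0.
rewrite {1}/kstep.
have -> : ev (traj c k) (w k) = \sum_j c j * ev (traj (unitvec j) k) (w k).
  rewrite /ev; under eq_bigr do rewrite IH mulr_suml.
  rewrite exchange_big/=; apply: eq_bigr => j _; rewrite mulr_sumr.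
  by apply: eq_bigr => l _; rewrite mulrA.
rewrite IH !mulr_suml -sumrB; apply: eq_bigr => j _.
by rewrite /kstep; ring.
Qed.

(** The trajectories of the unit vectors are the columns of the product of projections; the sum is
    its squared Frobenius norm, which dominates the operator norm by Cauchy-Schwarz in each
    coordinate. *)
Lemma nsq_traj_le c k :
  nsq (traj c k) <= nsq c * \sum_j nsq (traj (unitvec j) k).
Proof.
rewrite /nsq exchange_big/= mulr_sumr; apply: ler_sum => i _.
by rewrite traj_linear; exact: (sqn_ev_le c (fun j => traj (unitvec j) k i)).
Qed.

(* If c is nearly orthogonal to all the [w l], the projections hardly move it,
   so a contracting product of projections bounds the frame from below. *)
Lemma frame_lower_bound c M : \sum_j nsq (traj (unitvec j) M) <= 4^-1 ->
  nsq c <= 4 * \sum_(l < M) sqn (ev c (w l)) / nsq (w l).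
Proof.
move=> small; set A := \sum_(l < M) _.
(* The pairing of [c] with its trajectory changes at each step by the amount given in
   [Re_dot_kstep]. *)
have dot k : \sum_i Re (c i * conjc (traj c k i)) = nsq c -
    \sum_(l < k) Re (ev c (w l) * conjc (ev (traj c l) (w l))) / nsq (w l).
  elim: k => [|k IH].
    rewrite big_ord0 subr0; apply: eq_bigr => i _.
    by rewrite /sqn !ReImE /=; ring.
  rewrite big_ord_recr/= opprD addrA -IH -Re_dot_kstep -sumrB.
  by apply: eq_bigr => i _; rewrite !ReImE; ring.
(* AM-GM in each term; the parts coming from the trajectory add up to its total loss of squared
   norm, by [nsq_traj]. *)
have lb : \sum_(l < M) Re (ev c (w l) * conjc (ev (traj c l) (w l))) / nsq (w l)
    <= A + (nsq c - nsq (traj c M)) / 4.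
  rewrite -(nsq_traj c M) addrAC subrr add0r mulr_suml -big_split/=.
  apply: ler_sum => l _; rewrite mulrAC -mulrDl ler_wpM2r ?invr_ge0 ?nsq_ge0//.
  exact: Re_mul_conjc_le.
have ub : \sum_i Re (c i * conjc (traj c M i)) <= nsq (traj c M) + nsq c / 4.
  rewrite /nsq mulr_suml -big_split/=; apply: ler_sum => i _.
  have := Re_mul_conjc_le (traj c M i) (c i).
  by rewrite !ReImE; lra.
(* With T the final squared norm, the bounds give [nsq c / 2 <= A + 3 T / 4] and [T <= nsq c / 4],
   hence [5 / 16 * nsq c <= A]. *)
have := nsq_traj_le c M.
have := ler_wpM2l (nsq_ge0 c) small.
by move: ub; rewrite dot; have := nsq_ge0 c; lra.
Qed.

(* Fraction-free Gaussian elimination: as long as no pivot is 0, the rows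
   [elim_rows k i], k <= i < N, span the solutions c of
   [ev c (w l) = 0], l < k. *)
Fixpoint elim_rows k (i : nat) : 'I_N -> R[i] :=
  if k is k'.+1 then fun j =>
    ev (elim_rows k' k') (w k') * elim_rows k' i j
    - ev (elim_rows k' i) (w k') * elim_rows k' k' j
  else fun j => (i == j)%:R.

Definition pivot k := ev (elim_rows k k) (w k).

(** Row [k] vanishes in the columns after [k], so eliminating with it only rescales the remaining
    rows there by the pivot. *)
Lemma elim_diag k (i : nat) (j : 'I_N) : (k <= i)%N -> (k <= j)%N ->
  elim_rows k i j = (i == j)%:R * \prod_(l < k) pivot l.
Proof.
elim: k i j => [|k IH] i j; first by rewrite big_ord0 mulr1.
move=> ki kj /=; rewrite !IH ?(ltnW ki) ?(ltnW kj)//.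
by rewrite (ltn_eqF kj) mul0r mulr0 subr0 big_ord_recr/= /pivot; ring.
Qed.

Lemma elim_neq0 k : (k < N)%N -> (forall l, (l < k)%N -> pivot l != 0) ->
  nsq (elim_rows k k) != 0.
Proof.
move=> kN piv; apply/eqP => /nsq_eq0 /(_ (Ordinal kN)).
rewrite elim_diag//= eqxx mul1r => /eqP.
by rewrite prodf_seq_eq0 => /hasP[l _]; apply/negP/piv/ltn_ord.
Qed.

Lemma elim_injective c : (forall l, (l < N)%N -> pivot l != 0) ->
  (forall l, (l < N)%N -> ev c (w l) = 0) -> forall i, c i = 0.
Proof.
move=> piv c0.
(* Invariant: a nonzero multiple of [c] is a combination of the rows of index at least [k]. For
   [k = N] no row is left. *)
suff /(_ N (leqnn N)) [q [a [q0 qc]]] : forall k, (k <= N)%N ->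
    exists q : R[i], exists a : nat -> R[i], q != 0 /\
      forall j, q * c j = \sum_(k <= i < N) a i * elim_rows k i j.
  move=> i; apply/eqP; have := qc i; rewrite big_geq// => /eqP.
  by rewrite mulf_eq0 (negPf q0).
elim=> [_|k IH kN].
  exists 1, (fun i => if insub i is Some j then c j else 0); split.
    exact: oner_neq0.
  move=> j; rewrite mul1r big_mkord (bigD1 j)//= eqxx mulr1 valK.
  rewrite big1 ?addr0// => i ij.
  by rewrite (_ : (i == j :> nat) = false) ?mulr0//; apply/negbTE.
have [q [a [q0 qc]]] := IH (ltnW kN).
exists (pivot k * q), a; split; first by rewrite mulf_neq0// piv.
(* Pair the invariant with [w k], on which [c] vanishes. *)
have evc : \sum_(k <= i < N) a i * ev (elim_rows k i) (w k) = 0.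
  transitivity (q * ev c (w k)); last by rewrite c0// mulr0.
  rewrite /ev mulr_sumr; under [RHS]eq_bigr do rewrite mulrA qc mulr_suml.
  rewrite exchange_big/=; apply: eq_bigr => i _; rewrite mulr_sumr.
  by apply: eq_bigr => j _; rewrite mulrA.
move=> j; rewrite -mulrA qc mulr_sumr.
transitivity (\sum_(k <= i < N) a i * elim_rows k.+1 i j).
  transitivity (\sum_(k <= i < N) (pivot k * (a i * elim_rows k i j)
     - (a i * ev (elim_rows k i) (w k)) * elim_rows k k j)).
    by rewrite sumrB -mulr_suml evc mul0r subr0.
  by apply: eq_bigr => i _; rewrite /= /pivot; ring.
(* Row [k] eliminated against itself is 0, so the sum may start at [k.+1]. *)
by rewrite big_ltn//= subrr mulr0 add0r.
Qed.

End trajectory.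
End kaczmarz.

(** * Measurability of complex functions *)

Section complex_measurability.
Context {R : realType} {dT : measure_display} {T : measurableType dT}.
Implicit Types f g : T -> R[i].

Definition cmeas f : Prop :=
  measurable_fun setT (fun t => Re (f t)) /\
  measurable_fun setT (fun t => Im (f t)).

Lemma cmeas_cst z : cmeas (cst z).
Proof. by split; exact: measurable_cst. Qed.

Lemma cmeas_real (r : T -> R) :
  measurable_fun setT r -> cmeas (fun t => (r t)%:C).
Proof. by move=> mr; split => //=; exact: measurable_cst. Qed.

Lemma cmeasD f g : cmeas f -> cmeas g -> cmeas (fun t => f t + g t).
Proof.
move=> [f1 f2] [g1 g2]; split; under eq_fun do rewrite !ReImE;
  exact: measurable_funD.
Qed.

Lemma cmeasN f : cmeas f -> cmeas (fun t => - f t).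
Proof.
move=> [f1 f2]; split; under eq_fun do rewrite !ReImE;
  exact: measurableT_comp.
Qed.

Lemma cmeasB f g : cmeas f -> cmeas g -> cmeas (fun t => f t - g t).
Proof. by move=> mf mg; apply: cmeasD => //; exact: cmeasN. Qed.

Lemma cmeasM f g : cmeas f -> cmeas g -> cmeas (fun t => f t * g t).
Proof.
move=> [f1 f2] [g1 g2]; split; under eq_fun do rewrite !ReImE.
  by apply: measurable_funB; exact: measurable_funM.
by apply: measurable_funD; exact: measurable_funM.
Qed.

Lemma cmeas_conjc f : cmeas f -> cmeas (fun t => conjc (f t)).
Proof.
move=> [f1 f2]; split; under eq_fun do rewrite !ReImE; first exact: f1.
exact: measurable_funN.
Qed.

Lemma cmeas_sum I (s : seq I) (h : I -> T -> R[i]) :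
  (forall i, cmeas (h i)) -> cmeas (fun t => \sum_(i <- s) h i t).
Proof.
move=> mh; split.
  under eq_fun do rewrite Re_sum.
  exact: (measurable_sum s (fun i => (mh i).1)).
under eq_fun do rewrite Im_sum.
exact: (measurable_sum s (fun i => (mh i).2)).
Qed.

Lemma measurable_sqn f : cmeas f -> measurable_fun setT (fun t => sqn (f t)).
Proof. by move=> [f1 f2]; apply: measurable_funD; exact: measurable_funX. Qed.

Lemma measurable_nsq N (s : T -> 'I_N -> R[i]) :
  (forall i, cmeas (s ^~ i)) -> measurable_fun setT (fun t => nsq (s t)).
Proof.
by move=> ms; exact: (measurable_sum _ (fun i => measurable_sqn (ms i))).
Qed.

Lemma cmeas_ev N (s w : T -> 'I_N -> R[i]) : (forall i, cmeas (s ^~ i)) ->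
  (forall i, cmeas (w ^~ i)) -> cmeas (fun t => ev (s t) (w t)).
Proof.
by move=> ms mw; exact: (cmeas_sum _ (fun i => cmeasM (ms i) (mw i))).
Qed.

(** On nonnegative reals the inverse is the power of exponent -1, including the value 0 at 0. *)
Lemma measurable_inv (r : T -> R) : (forall t, 0 <= r t) ->
  measurable_fun setT r -> measurable_fun setT (fun t => (r t)^-1).
Proof.
move=> r0 mr; under eq_fun do rewrite -powR_inv1//.
exact: (measurableT_comp (measurable_powR _)).
Qed.

(** Measurability is asked only of the vectors of index below [k], so that [T] can be the past of
    the first [k] samples. *)
Lemma cmeas_traj N (w : T -> nat -> 'I_N -> R[i]) c k :
  (forall l i, (l < k)%N -> cmeas (fun t => w t l i)) ->
  forall i, cmeas (fun t => traj (w t) c k i).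
Proof.
elim: k => [|k IH] mw i; first exact: cmeas_cst.
have mt := IH (fun l i lk => mw l i (ltnW lk)).
have mk i' := mw k i' (ltnSn k).
apply: cmeasB => //; apply: cmeasM; last exact: cmeas_conjc.
apply: cmeasM; first exact: cmeas_ev.
apply: cmeas_real; apply: measurable_inv => [t|]; first exact: nsq_ge0.
exact: measurable_nsq.
Qed.

Lemma cmeas_elim N (w : T -> nat -> 'I_N -> R[i]) k :
  (forall l i, (l < k)%N -> cmeas (fun t => w t l i)) ->
  forall i j, cmeas (fun t => elim_rows (w t) k i j).
Proof.
elim: k => [|k IH] mw i j; first exact: cmeas_cst.
have mt := IH (fun l i lk => mw l i (ltnW lk)).
have mk i' := mw k i' (ltnSn k).
by apply: cmeasB; apply: cmeasM => //; exact: cmeas_ev.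
Qed.

End complex_measurability.

Lemma cmeas_comp {R : realType} {d1 d2 : measure_display}
    {T1 : measurableType d1} {T2 : measurableType d2}
    (f : T2 -> R[i]) (g : T1 -> T2) :
  cmeas f -> measurable_fun setT g -> cmeas (f \o g).
Proof. by move=> [f1 f2] mg; split;
  [exact: (measurableT_comp f1 mg)|exact: (measurableT_comp f2 mg)]. Qed.

(** * Fubini for an independent sequence *)

Section fubini_independent.
Context {R : realType} {dO dT dE : measure_display}.
Context {Omega : measurableType dO}.
Context {T : measurableType dT} {E : measurableType dE}.
Variables (P : probability Omega R) (Z : {RV P >-> T}) (Y : {RV P >-> E}).
Hypothesis indep : forall A B, measurable A -> measurable B ->
  P (Z @^-1` A `&` Y @^-1` B) = (P (Z @^-1` A) * P (Y @^-1` B))%E.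
Local Open Scope ereal_scope.

(** By independence the law of the pair agrees with the product of the laws on rectangles, hence
    everywhere; then Tonelli's theorem applies. *)
Lemma fubini_independent (F : T * E -> \bar R) : measurable_fun setT F ->
  (forall z, 0 <= F z) ->
  \int[P]_t F (Z t, Y t) = \int[P]_t \int[distribution P Y]_y F (Z t, y).
Proof.
move=> mF F0.
have mZY : measurable_fun setT (fun t => (Z t, Y t)).
  by apply: measurable_fun_pair; exact: measurable_funPT.
rewrite -(@ge0_integral_pushforward _ _ _ _ _ _ mZY P setT F)//.
rewrite -(ge0_integral_distribution Z
  (f := fun z => \int[distribution P Y]_y F (z, y))); last 2 first.
- exact: measurable_fun_fubini_tonelli_F.
- by move=> z; apply: integral_ge0.
rewrite -(@fubini_tonelli1 _ _ _ _ _ (distribution P Z) (distribution P Y) F)//.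
apply: eq_measure_integral => /= A mA _; apply/esym.
exact: product_measure_unique.
Qed.

End fubini_independent.

Section independent_sequence.
Context {R : realType} {dO dE : measure_display}.
Context {Omega : measurableType dO} {E : measurableType dE}.
Variables (P : probability Omega R) (Y : nat -> {RV P >-> E}) (M : nat).
Hypothesis indep : forall k (B : nat -> set E), (k <= M)%N ->
  (forall i, measurable (B i)) ->
  P [set t | forall i, (i < k)%N -> B i (Y i t)] =
  (\prod_(i < k) P (Y i @^-1` B i))%E.

Definition past_cylinders k : set (set Omega) :=
  [set A | exists2 B : nat -> set E, (forall i, measurable (B i)) &
           A = [set t | forall i, (i < k)%N -> B i (Y i t)]].

(** The points of [Omega] with the sigma-algebra of the first [k] samples. The identity into this
    space is a random variable carrying the whole past. *)
Definition past k := g_sigma_algebraType (past_cylinders k).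

Lemma measurable_past k l : (l < k)%N ->
  measurable_fun [set: past k] (Y l : past k -> E).
Proof.
move=> lk _ B mB; rewrite setTI; apply: sub_sigma_algebra.
exists (fun i => if i == l then B else setT); first by move=> i; case: ifP.
apply/seteqP; split=> [t Bt i _|t /(_ l lk)] /=; last by rewrite eqxx.
by case: eqP => // ->.
Qed.

Lemma past_cylinders_measurable k : past_cylinders k `<=` measurable.
Proof.
move=> _ [B mB ->].
rewrite (_ : [set _ | _] = \bigcap_(i in `I_k) (Y i @^-1` B i)) //.
apply: fin_bigcap_measurable => [|i _]; first exact: finite_II.
by rewrite -[X in measurable X]setTI; exact: measurable_funPT.
Qed.

Lemma measurable_past_id k : measurable_fun [set: Omega] (id : Omega -> past k).
Proof.
move=> _ A mA; rewrite setTI.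
have : <<s past_cylinders k >> `<=` @measurable _ Omega.
  apply: smallest_sub; first exact: sigma_algebra_measurable.
  exact: past_cylinders_measurable.
by apply.
Qed.

(** Both sides are finite measures in [A]. They agree on the cylinders, which are stable under
    intersection and generate the past. *)
Lemma past_independent k (A : set Omega) (B : set E) : (k < M)%N ->
  <<s past_cylinders k >> A -> measurable B ->
  P (A `&` Y k @^-1` B) = (P A * P (Y k @^-1` B))%E.
Proof.
move=> kM sA mB.
have mYB : measurable (Y k @^-1` B).
  by rewrite -[X in measurable X]setTI; exact: measurable_funPT.
have pYB : P (Y k @^-1` B) \is a fin_num by rewrite fin_num_measure.
pose m1 := mrestr P mYB.
pose m2 := mscale (NngNum (fine_ge0 (measure_ge0 P (Y k @^-1` B)))) P.
have m2E C : m2 C = (P C * P (Y k @^-1` B))%E.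
  by rewrite /m2 /mscale/= muleC; congr (_ * _)%E; exact: fineK.
rewrite -m2E.
rewrite -[LHS]/(m1 A).
apply: (g_sigma_algebra_measure_unique (past_cylinders k) _ (fun=> setT)) => //.
- exact: past_cylinders_measurable.
- by move=> _; exists (fun=> setT) => //; apply/seteqP; split.
- by rewrite bigcup_const//; exists 0%N.
- move=> _ _ [B1 mB1 ->] [B2 mB2 ->]; exists (fun i => B1 i `&` B2 i).
    by move=> i; exact: measurableI.
  apply/seteqP; split => [t [t1 t2] i ik|t t12].
    by split; [exact: t1|exact: t2].
  by split => i ik; have [] := t12 i ik.
- move=> _ [C mC ->]; rewrite -[LHS]/(m1 _) -[RHS]/(m2 _) m2E /m1 /mrestr.
  rewrite indep ?(ltnW kM)//.
  (* The event on sample [k] becomes one more factor of the cylinder. *)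
  pose D i := if i == k then B else C i.
  rewrite (_ : _ `&` _ = [set t | forall i, (i < k.+1)%N -> D i (Y i t)]).
    rewrite indep//; last by move=> i; rewrite /D; case: ifP.
    rewrite big_ord_recr/= /D eqxx; congr (_ * _)%E.
    by apply: eq_bigr => i _; rewrite (ltn_eqF (ltn_ord i)).
  apply/seteqP; split => [t [tC tB] i|t tD].
    by rewrite ltnS leq_eqVlt /D; case: eqP => [-> _|_ /=]; [exact: tB|exact: tC].
  split; last by have := tD k (ltnSn k); rewrite /D eqxx.
  by move=> i ik; have := tD i (leqW ik); rewrite /D (ltn_eqF ik).
- move=> _; rewrite -[X in (X < _)%E]/(m1 _) /m1 /mrestr.
  by rewrite (le_lt_trans (probability_le1 _ _)) ?ltry//; exact: measurableI.
Qed.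

Lemma fubini_past k (F : past k * E -> \bar R) : (k < M)%N ->
  measurable_fun setT F -> (forall z, 0 <= F z)%E ->
  (\int[P]_t F (t, Y k t) =
   \int[P]_t \int[distribution P (Y k)]_y F (t : past k, y))%E.
Proof.
move=> kM mF F0.
pose Z : {RV P >-> past k} := mfun_Sub (mem_set (@measurable_past_id k)).
apply: (@fubini_independent _ _ _ _ _ _ _ P Z (Y k)) => // A B mA mB.
exact: past_independent.
Qed.

End independent_sequence.

(** * Sampling from the induced measure *)

Section density.
Context {R : realType} {dE : measure_display} {E : measurableType dE}.
Variables (nu mu : {measure set E -> \bar R}) (k : E -> R).
Hypotheses (mk : measurable_fun setT k) (k0 : forall x, 0 <= k x).
Hypothesis nuE : forall B, measurable B ->
  nu B = (\int[mu]_(x in B) (k x)%:E)%E.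
Local Open Scope ereal_scope.
Import HBNNSimple.

Let density_nnsfun (h : {nnsfun E >-> R}) :
  \int[nu]_x (h x)%:E = \int[mu]_x ((h x)%:E * (k x)%:E).
Proof.
rewrite integralT_nnsfun sintegralE.
transitivity (\int[mu]_x (\sum_(r \in range h)
    ((r * \1_(h @^-1` [set r]) x)%:E * (k x)%:E))).
  rewrite ge0_integral_fsum//; last 2 first.
  - move=> r; apply: emeasurable_funM; apply/measurable_EFinP => //.
    by apply: measurable_funM => //; exact: measurable_indic.
  - move=> r x _; rewrite mule_ge0 ?lee_fin// -lee_fin EFinM.
    exact: nnfun_muleindic_ge0.
  apply: eq_fsbigr => r /[!inE] -[x _ <-].
  rewrite nuE; last by rewrite -[X in measurable X]setTI; exact: measurable_funPT.
  rewrite -ge0_integralZl//; last 3 first.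
  - exact/measurable_EFinP/measurable_funTS.
  - by move=> y _; rewrite lee_fin.
  - by rewrite lee_fin.
  rewrite integral_mkcond; apply: eq_integral => y _.
  rewrite patchE indicE; case: ifPn => yx /=.
    by rewrite mulr1.
  by rewrite mulr0 mul0e.
apply: eq_integral => x _; rewrite -ge0_mule_fsuml; last first.
  by move=> r; rewrite EFinM nnfun_muleindic_ge0.
by rewrite fsumEFin// -fimfunE.
Qed.

(** Monotone convergence from the case of simple functions. *)
Lemma integral_density (g : E -> \bar R) : measurable_fun setT g ->
  (forall x, 0 <= g x) -> \int[nu]_x g x = \int[mu]_x (g x * (k x)%:E).
Proof.
move=> mg g0; pose h := nnsfun_approx measurableT mg.
have hg x : EFin \o h ^~ x @ \oo --> g x.
  by apply: cvg_nnsfun_approx => //.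
transitivity (limn (fun n => \int[nu]_x (h n x)%:E)).
  rewrite -monotone_convergence//; last 3 first.
  - by move=> n; exact/measurable_EFinP.
  - by move=> n x _; rewrite lee_fin.
  - by move=> x _ a b ab; rewrite lee_fin; exact/lefP/nd_nnsfun_approx.
  by apply: eq_integral => x _; apply/esym/cvg_lim => //; exact: hg.
under eq_fun do rewrite density_nnsfun.
rewrite -monotone_convergence//; last 3 first.
- by move=> n; apply: emeasurable_funM; exact/measurable_EFinP.
- by move=> n x _; rewrite mule_ge0 ?lee_fin.
- move=> x _ a b ab; rewrite lee_wpmul2r ?lee_fin//.
  exact/lefP/nd_nnsfun_approx.
apply: eq_integral => x _; apply/cvg_lim => //.
by apply: cvgeZr => //; exact: hg.
Qed.

End density.

Section sampling.
Context {R : realType} {dO dE : measure_display}.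
Context {Omega : measurableType dO} {E : measurableType dE}.
Variables (mu : {measure set E -> \bar R}) (N : nat) (v : 'I_N -> E -> R[i]).
Hypothesis mv : forall i, cmeas (v i).
Hypothesis parseval : forall c,
  (\int[mu]_x (sqn (ev c (v^~ x)))%:E = (nsq c)%:E)%E.
Variables (P : probability Omega R) (Y : nat -> {RV P >-> E}) (M : nat).
Hypothesis indep : forall k (B : nat -> set E), (k <= M)%N ->
  (forall i, measurable (B i)) ->
  P [set t | forall i, (i < k)%N -> B i (Y i t)] =
  (\prod_(i < k) P (Y i @^-1` B i))%E.
Hypothesis law : forall k B, (k < M)%N -> measurable B ->
  P (Y k @^-1` B) = ((N%:R^-1)%:E * \int[mu]_(x in B) (nsq (v^~ x))%:E)%E.

Let w (t : Omega) (l : nat) : 'I_N -> R[i] := v^~ (Y l t).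

Let measurable_nsq_v : measurable_fun setT (fun x => nsq (v^~ x)).
Proof. exact: measurable_nsq. Qed.

Lemma integral_sample k (g : E -> \bar R) : (k < M)%N ->
  measurable_fun setT g -> (forall x, 0 <= g x)%E ->
  (\int[distribution P (Y k)]_x g x =
   \int[mu]_x (g x * (N%:R^-1 * nsq (v^~ x))%:E))%E.
Proof.
move=> kM mg g0; apply: integral_density => //.
- exact: measurable_funM.
- by move=> x; rewrite mulr_ge0 ?nsq_ge0.
move=> B mB; rewrite -[LHS]/(P (Y k @^-1` B)) law// -ge0_integralZl//.
- exact/measurable_EFinP/measurable_funTS.
- by move=> x _; rewrite lee_fin nsq_ge0.
Qed.

(** Isotropy of the normalized sample: the density cancels the normalization, and Parseval's
    identity remains. *)
Lemma integral_sample_sqn k c : (k < M)%N ->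
  (\int[distribution P (Y k)]_x (sqn (ev c (v^~ x)) / nsq (v^~ x))%:E =
   (N%:R^-1 * nsq c)%:E)%E.
Proof.
move=> kM.
have mc : measurable_fun setT (fun x => sqn (ev c (v^~ x))).
  by apply/measurable_sqn/cmeas_ev => // i; exact: cmeas_cst.
rewrite integral_sample//; last 2 first.
- apply/measurable_EFinP/measurable_funM => //.
  by apply: measurable_inv => // x; exact: nsq_ge0.
- by move=> x; rewrite lee_fin divr_ge0 ?sqn_ge0 ?nsq_ge0.
rewrite EFinM -parseval -ge0_integralZl//.
- apply: eq_integral => x _; rewrite -!EFinM mulrCA; congr (_ * _)%:E.
  (* Where the density vanishes all basis functions do, so both sides are 0. *)
  have [v0|v0] := eqVneq (nsq (v^~ x)) 0; last by rewrite divfK.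
  by rewrite v0 mulr0 ev0r// sqn0.
- exact/measurable_EFinP.
- by move=> x _; rewrite lee_fin sqn_ge0.
Qed.

Let cmeas_w_past k l i : (l < k)%N ->
  cmeas ((fun t => w t l i) : past Y k -> R[i]).
Proof.
move=> lk.
exact: (cmeas_comp (mv i) (@measurable_past _ _ _ _ _ P Y k l lk)).
Qed.

Let cmeas_w l i : cmeas (fun t => w t l i).
Proof. by apply: (cmeas_comp (mv i)); exact: measurable_funPT. Qed.

Let measurable_nsq_traj c k :
  measurable_fun setT (fun t => nsq (traj (w t) c k)).
Proof. by apply: measurable_nsq; exact: cmeas_traj. Qed.

(* One projection removes on average the fraction 1/N of the squared norm. *)
Lemma integral_nsq_traj c k : (k <= M)%N ->
  (\int[P]_t (nsq (traj (w t) c k))%:E = ((1 - N%:R^-1) ^+ k * nsq c)%:E)%E.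
Proof.
elim: k => [_|k IH kM].
  rewrite -[LHS]/(\int[P]_t (cst (nsq c)%:E t))%E integral_cst//.
  rewrite expr0 mul1r -[RHS]mule1; congr (_ * _)%E; exact: probability_setT.
pose drop t := sqn (ev (traj (w t) c k) (w t k)) / nsq (w t k).
have mdrop : measurable_fun setT drop.
  apply: measurable_funM.
    by apply/measurable_sqn/cmeas_ev => // i; exact: cmeas_traj.
  by apply: measurable_inv => [t|]; [exact: nsq_ge0|exact: measurable_nsq].
have drop0 t : 0 <= drop t by rewrite divr_ge0 ?sqn_ge0 ?nsq_ge0.
(* The trajectory up to [k] depends on earlier samples only: freeze it and integrate over sample [k]
   first, using isotropy. *)
have Edrop : (\int[P]_t (drop t)%:E =
              (N%:R^-1)%:E * \int[P]_t (nsq (traj (w t) c k))%:E)%E.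
  pose F (z : past Y k * E) : \bar R :=
    (sqn (ev (traj (w z.1) c k) (v^~ z.2)) / nsq (v^~ z.2))%:E.
  have mtraj i : cmeas (fun z : past Y k * E => traj (w z.1) c k i).
    apply: (cmeas_comp (f := fun t : past Y k => traj (w t) c k i)).
      by apply: cmeas_traj => l j; exact: cmeas_w_past.
    exact: measurable_fst.
  have mvz i : cmeas (fun z : past Y k * E => v i z.2).
    exact: (cmeas_comp (mv i) measurable_snd).
  rewrite -[LHS]/(\int[P]_t F (t, Y k t))%E (fubini_past indep)//; last 2 first.
  - apply/measurable_EFinP/measurable_funM.
      exact/measurable_sqn/cmeas_ev.
    by apply: measurable_inv => [t|]; [exact: nsq_ge0|exact: measurable_nsq].
  - by move=> z; rewrite lee_fin divr_ge0 ?sqn_ge0 ?nsq_ge0.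
  rewrite -ge0_integralZl//.
  - apply: eq_integral => t _; rewrite -EFinM.
    by rewrite -(integral_sample_sqn (traj (w t) c k) kM).
  - exact/measurable_EFinP.
  - by move=> t _; rewrite lee_fin nsq_ge0.
have : (\int[P]_t ((nsq (traj (w t) c k.+1))%:E + (drop t)%:E) =
        \int[P]_t (nsq (traj (w t) c k))%:E)%E.
  by apply: eq_integral => t _; rewrite -EFinD /= nsq_kstep subrK.
rewrite ge0_integralD//; last 4 first.
- by move=> t _; rewrite lee_fin nsq_ge0.
- exact/measurable_EFinP.
- by move=> t _; rewrite lee_fin.
- exact/measurable_EFinP.
rewrite Edrop (IH (ltnW kM)) -EFinM => /eqP.
rewrite eq_sym -sube_eq ?fin_num_adde_defl// => /eqP <-.
by rewrite -EFinB; congr EFin; rewrite exprS; ring.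
Qed.

Definition bad_frame : set Omega :=
  [set t | ~ (\sum_j nsq (traj (w t) (unitvec j) M) <= 4^-1)%R].

Let measurable_sum_nsq_traj :
  measurable_fun setT (fun t => \sum_j nsq (traj (w t) (unitvec j) M)).
Proof.
exact: (measurable_sum _ (fun j => measurable_nsq_traj (unitvec j) M)).
Qed.

Lemma measurable_bad_frame : measurable bad_frame.
Proof.
rewrite (_ : bad_frame = (fun t => \sum_j nsq (traj (w t) (unitvec j) M))
    @^-1` `]4^-1, +oo[%classic).
  by rewrite -[X in measurable X]setTI; exact: measurable_sum_nsq_traj.
apply/seteqP; split => t; rewrite /bad_frame /= in_itv/= andbT ltNge.
  by move/negP.
by move/negP.
Qed.

(** Markov's inequality at level 1/4 for the squared Frobenius norm, whose mean is a sum over the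
    [N] unit vectors. *)
Lemma probability_bad_frame :
  (P bad_frame <= (4 * N%:R * (1 - N%:R^-1) ^+ M)%:E)%E.
Proof.
pose S t := \sum_j nsq (traj (w t) (unitvec j) M).
have mS : measurable_fun setT S by exact: measurable_sum_nsq_traj.
have S0 t : 0 <= S t by apply: sumr_ge0 => j _; exact: nsq_ge0.
have ES : (\int[P]_t (S t)%:E = (N%:R * (1 - N%:R^-1) ^+ M)%:E)%E.
  under eq_integral do rewrite -sumEFin.
  rewrite ge0_integral_sum//; last 2 first.
  - by move=> j; exact/measurable_EFinP.
  - by move=> j t _; rewrite lee_fin nsq_ge0.
  under eq_bigr do rewrite integral_nsq_traj// nsq_unitvec mulr1.
  by rewrite sumEFin sumr_const card_ord mulr_natl.
set A := bad_frame; have mA : measurable A by exact: measurable_bad_frame.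
have -> : P A = (\int[P]_t (\1_A t)%:E)%E by rewrite integral_indic// setIT.
rewrite -mulrA EFinM -ES -ge0_integralZl//; last 2 first.
- exact/measurable_EFinP.
- by move=> t _; rewrite lee_fin.
apply: ge0_le_integral => //.
- by apply/measurable_EFinP; exact: measurable_indic.
- under eq_fun do rewrite -EFinM.
  by apply/measurable_EFinP; exact: measurable_funM.
- move=> t _; rewrite -EFinM lee_fin indicE; case: (boolP (t \in A)) => [|_].
    rewrite inE /A /bad_frame /= => /negP; rewrite -ltNge -/(S t) => /ltW St.
    by rewrite -ler_pdivrMl// mulr1.
  by rewrite mulr_ge0.
Qed.

Hypothesis zero_sets : forall c, nsq c != 0 ->
  (\int[mu]_(x in [set x | ev c (v^~ x) = 0%R]) (nsq (v^~ x))%:E = 0)%E.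

(** Row [k] is determined by the first [k] samples. Once these are frozen it is a fixed vector, and
    if it is nonzero the next sample almost surely avoids the zero set of its function. *)
Lemma pivot_neq0_ae k : (k < M)%N ->
  {ae P, forall t, nsq (elim_rows (w t) k k) != 0 -> pivot (w t) k != 0}.
Proof.
move=> kM.
pose S : set (past Y k * E) := ~` [set z | nsq (elim_rows (w z.1) k k) = 0] `&`
  [set z | sqn (ev (elim_rows (w z.1) k k) (v^~ z.2)) = 0].
have melim i : cmeas (fun z : past Y k * E => elim_rows (w z.1) k k i).
  apply: (cmeas_comp (f := fun t : past Y k => elim_rows (w t) k k i)).
    by apply: cmeas_elim => l j; exact: cmeas_w_past.
  exact: measurable_fst.
have mvz i : cmeas (fun z : past Y k * E => v i z.2).
  exact: (cmeas_comp (mv i) measurable_snd).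
have mS : measurable S.
  apply: measurableI; [apply: measurableC|].
    rewrite -[X in measurable X]setTI.
    exact: (measurable_nsq melim measurableT (measurable_set1 0)).
  rewrite -[X in measurable X]setTI.
  exact: (measurable_sqn (cmeas_ev melim mvz) measurableT (measurable_set1 0)).
have mY : measurable_fun setT (fun t : Omega => (t : past Y k, Y k t)).
  apply: measurable_fun_pair; last exact: measurable_funPT.
  exact: measurable_past_id.
exists ((fun t => (t : past Y k, Y k t)) @^-1` S); split.
- by rewrite -[X in measurable X]setTI; exact: mY.
- transitivity (\int[P]_t (\1_S (t : past Y k, Y k t))%:E)%E.
    set B := _ @^-1` S; have mB : measurable (B : set Omega).
      by rewrite -[X in measurable X]setTI; exact: mY.
    by rewrite -[B in LHS]setIT -integral_indic.
  rewrite (fubini_past indep (F := fun z => (\1_S z)%:E))//; last first.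
    by apply/measurable_EFinP; exact: measurable_indic.
  apply: integral0_eq => t _.
  have mSt : measurable (xsection S t) by exact: measurable_xsection.
  have [e0|e0] := eqVneq (nsq (elim_rows (w t) k k)) 0.
    by apply: integral0_eq => x _; rewrite indicE memNset// => -[/=].
  have mc : measurable [set x | ev (elim_rows (w t) k k) (v^~ x) = 0].
    rewrite (_ : [set _ | _] =
        (fun x => sqn (ev (elim_rows (w t) k k) (v^~ x))) @^-1` [set 0]).
      rewrite -[X in measurable X]setTI; apply: measurable_sqn => //.
      by apply: cmeas_ev => // i; exact: cmeas_cst.
    apply/seteqP; split=> x /= /eqP; rewrite ?sqn_eq0 => /eqP// ->.
    by rewrite sqn0.
  transitivity (distribution P (Y k)
      [set x | ev (elim_rows (w t) k k) (v^~ x) = 0]).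
    rewrite -[X in _ = distribution _ _ X]setIT -integral_indic//.
    apply: eq_integral => x _.
    congr EFin; rewrite !indicE; congr (nat_of_bool _)%:R.
    apply/idP/idP; rewrite !inE /S /=.
      by move=> [_ /eqP]; rewrite sqn_eq0 => /eqP.
    by move=> ->; rewrite sqn0; split => //; exact/eqP.
  by rewrite -[LHS]/(P (Y k @^-1` _)) law// zero_sets// mule0.
- move=> t /= /not_implyP[e0 /negP]; rewrite negbK => /eqP pv.
  split => /=; first exact/eqP.
  by rewrite -/(w t k) -/(pivot (w t) k) pv sqn0.
Qed.

Lemma sampling_injective_ae : (N <= M)%N ->
  {ae P, forall t c, (forall l, (l < N)%N -> ev c (w t l) = 0) ->
    forall i, c i = 0}.
Proof.
move=> NM.
have : {ae P, forall t (k : nat), (k < M)%N ->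
    nsq (elim_rows (w t) k k) != 0 -> pivot (w t) k != 0}.
  apply: ae_foralln => k; have [kM|Mk] := ltnP k M.
    by apply: filterS (pivot_neq0_ae kM) => t + _.
  by apply: aeW => t.
apply: filterS => t piv c; apply: elim_injective.
(* Nonzero earlier pivots keep row [l] nonzero, which in turn makes pivot [l] nonzero. *)
elim/ltn_ind=> l IH lN; apply: piv; first exact: leq_trans lN NM.
by apply: elim_neq0 => // j jl; apply: IH => //; exact: ltn_trans lN.
Qed.

End sampling.

(** * Orthonormal bases in L2 *)

Section support.
Context {R : realType} {d : nat}.
Local Notation E := (borelRn R d).
Variable mu : probability E R.

(** The support is closed: its complement is the union of the open null sets. *)
Lemma measurable_supp : measurable (supp mu).
Proof.
rewrite -[supp mu]setCK; apply: measurableC; apply: sub_sigma_algebra.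
rewrite (_ : ~` supp mu =
    \bigcup_(U in [set U : set 'rV[R]_d | open U /\ ~ (0 < mu U)%E]) U).
  by apply: bigcup_open => U [].
apply/seteqP; split => [x|x [U [oU U0] Ux] /(_ U oU Ux)//].
move=> /existsNP[U] /not_implyP[oU] /not_implyP[Ux U0].
by exists U.
Qed.

End support.

Section square_integrable.
Context {R : realType} {d : nat}.
Local Notation E := (borelRn R d).
Variable mu : probability E R.
Implicit Types f g : E -> R[i].

(** Extension by 0 outside the measurable set [supp mu] preserves measurability. *)
Lemma L2_cmeas f : L2 mu f -> cmeas f.
Proof.
move=> [f0 mre mim _]; have mD := measurable_supp mu.
have E0 (h : R[i] -> R) : h 0 = 0 ->
    (fun x => h (f x)) = (fun x => h (f x)) \_ (supp mu).
  move=> h0; apply/funext => x; rewrite patchE; case: ifPn => // /negP.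
  by rewrite inE => /f0 ->.
by split; rewrite E0//; exact/(measurable_restrictT _ mD).
Qed.

Lemma L2_integrable f : L2 mu f ->
  mu.-integrable (supp mu) (fun x => (sqn (f x))%:E).
Proof.
move=> Lf; have mf := L2_cmeas Lf; have mD := measurable_supp mu.
have [_ _ _ fi] := Lf.
apply/integrableP; split.
  by apply/measurable_EFinP/measurable_funTS; exact: measurable_sqn.
under eq_integral do rewrite gee0_abs ?lee_fin ?sqn_ge0//.
by under eq_integral do rewrite -cabs_sqr.
Qed.

Let norm_mul_le (a b : R) :
  - (a ^+ 2 + b ^+ 2) / 2 <= a * b <= (a ^+ 2 + b ^+ 2) / 2.
Proof.
have := sqr_ge0 (a + b); have := sqr_ge0 (a - b).
by lra.
Qed.

Lemma L2_integrable_dominated f g (h : E -> R) : L2 mu f -> L2 mu g ->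
  measurable_fun setT h -> (forall x, `|h x| <= sqn (f x) + sqn (g x)) ->
  mu.-integrable (supp mu) (EFin \o h).
Proof.
move=> Lf Lg mh hfg; have mD := measurable_supp mu.
apply: (@le_integrable _ _ _ mu _ mD _
    (fun x => (sqn (f x))%:E + (sqn (g x))%:E)%E).
- by apply/measurable_EFinP; exact: measurable_funTS.
- move=> x _ /=; rewrite lee_fin (le_trans (hfg x))//.
  exact: ler_norm.
- by apply: integrableD => //; exact: L2_integrable.
Qed.

Lemma integrable_Re_dot f g : L2 mu f -> L2 mu g ->
  mu.-integrable (supp mu) (EFin \o (fun x => Re (f x * conjc (g x)))).
Proof.
move=> Lf Lg; apply: (L2_integrable_dominated Lf Lg).
  by have [] := cmeasM (L2_cmeas Lf) (cmeas_conjc (L2_cmeas Lg)).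
move=> x; rewrite ler_norml /sqn !ReImE mulrN opprK.
have := norm_mul_le (Re (f x)) (Re (g x)).
have := norm_mul_le (Im (f x)) (Im (g x)).
by lra.
Qed.

Lemma integrable_Im_dot f g : L2 mu f -> L2 mu g ->
  mu.-integrable (supp mu) (EFin \o (fun x => Im (f x * conjc (g x)))).
Proof.
move=> Lf Lg; apply: (L2_integrable_dominated Lf Lg).
  by have [] := cmeasM (L2_cmeas Lf) (cmeas_conjc (L2_cmeas Lg)).
move=> x; rewrite ler_norml /sqn !ReImE mulrN.
have := norm_mul_le (Re (f x)) (Im (g x)).
have := norm_mul_le (Im (f x)) (Re (g x)).
by lra.
Qed.

End square_integrable.

Section orthonormal.
Context {R : realType} {d : nat}.
Local Notation E := (borelRn R d).
Variables (mu : probability E R) (V : set (E -> R[i])) (N : nat).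
Variable v : 'I_N -> E -> R[i].
Hypothesis hv : orthonormal_basis mu V v.

Lemma linear_combE c (x : E) : (\sum_(i < N) c i *: v i) x = ev c (v^~ x).
Proof. by rewrite fct_sumE. Qed.

Lemma basis_mem i : V (v i).
Proof.
have [_ -> _] := hv; exists (unitvec i).
rewrite (bigD1 i)//= /unitvec eqxx scale1r big1 ?addr0// => j /negPf ->.
by rewrite scale0r.
Qed.

Lemma basis_L2 i : L2 mu (v i).
Proof. by have [VL _ _] := hv; apply/VL/basis_mem. Qed.

Lemma basis_cmeas i : cmeas (v i).
Proof. exact/(@L2_cmeas _ _ mu)/basis_L2. Qed.

Lemma basis_off i x : ~ supp mu x -> v i x = 0.
Proof. by move=> Dx; have [/(_ x Dx)] := basis_L2 i. Qed.

Lemma ev_off c x : ~ supp mu x -> ev c (v^~ x) = 0.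
Proof. by move=> Dx; apply: big1 => i _; rewrite basis_off// mulr0. Qed.

Lemma nsq_off x : ~ supp mu x -> nsq (v^~ x) = 0.
Proof. by move=> Dx; apply: big1 => i _; rewrite basis_off// sqn0. Qed.

Lemma KdiagE x : Kdiag v x = nsq (v^~ x).
Proof. by apply: eq_bigr => i _; exact: cabs_sqr. Qed.

(** The integrals in [inner] are real parts taken by [fine] of extended ones; integrability of the
    products allows [fine] to be undone. *)
Lemma integral_basis i j :
  (\int[mu]_(x in supp mu) (Re (v i x * conjc (v j x)))%:E = (i == j)%:R%:E)%E
  /\ (\int[mu]_(x in supp mu) (Im (v i x * conjc (v j x)))%:E = 0)%E.
Proof.
have [_ _ /(_ i j)] := hv; rewrite /inner /Rintegral => ij.
have mD := measurable_supp mu.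
have fr := integrable_fin_num mD (integrable_Re_dot (basis_L2 i) (basis_L2 j)).
have fi := integrable_fin_num mD (integrable_Im_dot (basis_L2 i) (basis_L2 j)).
rewrite -(fineK fr) -(fineK fi); split; congr EFin.
  by move/(congr1 (@Re R)) : ij => /= ->; case: eqP.
by move/(congr1 (@Im R)) : ij => /= ->; case: eqP.
Qed.

Lemma parseval c : (\int[mu]_x (sqn (ev c (v^~ x)))%:E = (nsq c)%:E)%E.
Proof.
have mD := measurable_supp mu.
transitivity (\int[mu]_(x in supp mu) (sqn (ev c (v^~ x)))%:E)%E.
  rewrite [RHS]integral_mkcond; apply: eq_integral => x _.
  rewrite patchE; case: ifPn => // /negP; rewrite inE => /(ev_off c) ->.
  by rewrite sqn0.
(* The real part of the term of index [(i, j)] in the expanded square, split into real integrals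
   known from orthonormality. *)
pose h (p : 'I_N * 'I_N) (x : E) : \bar R :=
  ((Re (c p.1 * conjc (c p.2)))%:E * (Re (v p.1 x * conjc (v p.2 x)))%:E +
   (- Im (c p.1 * conjc (c p.2)))%:E * (Im (v p.1 x * conjc (v p.2 x)))%:E)%E.
transitivity (\int[mu]_(x in supp mu) \sum_(p : 'I_N * 'I_N) h p x)%E.
  apply: eq_integral => x _.
  transitivity ((Re (ev c (v^~ x) * conjc (ev c (v^~ x))))%:E).
    by congr EFin; rewrite /sqn !ReImE; ring.
  rewrite /ev rmorph_sum mulr_suml Re_sum -sumEFin.
  rewrite -(pair_bigA _ (fun i j => h (i, j) x))/=; apply: eq_bigr => i _.
  rewrite mulr_sumr Re_sum -sumEFin; apply: eq_bigr => j _.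
  by rewrite /h /= -!EFinM -EFinD; congr EFin; rewrite !ReImE; ring.
have ih1 p := integrableZl mD (Re (c p.1 * conjc (c p.2)))
  (integrable_Re_dot (basis_L2 p.1) (basis_L2 p.2)).
have ih2 p := integrableZl mD (- Im (c p.1 * conjc (c p.2)))
  (integrable_Im_dot (basis_L2 p.1) (basis_L2 p.2)).
rewrite integral_sum//; last by move=> p; exact: integrableD.
transitivity (\sum_(p : 'I_N * 'I_N)
    (Re (c p.1 * conjc (c p.2)) * (p.1 == p.2)%:R)%:E)%E.
  apply: eq_bigr => p _; rewrite integralD// !integralZl//.
  - by have [-> ->] := integral_basis p.1 p.2; rewrite mule0 adde0.
  - exact: integrable_Im_dot (basis_L2 _) (basis_L2 _).
  - exact: integrable_Re_dot (basis_L2 _) (basis_L2 _).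
rewrite sumEFin; congr EFin.
rewrite -(pair_bigA _ (fun i j => Re (c i * conjc (c j)) * (i == j)%:R))/=.
apply: eq_bigr => i _; rewrite (bigD1 i)//= eqxx mulr1 big1 ?addr0.
  by rewrite /sqn !ReImE; ring.
by move=> j; rewrite eq_sym => /negPf ->; rewrite mulr0.
Qed.

(** By Parseval the coefficient vector of the constant 1 has squared norm at most 1; Cauchy-Schwarz
    at [x] then bounds 1 by [nsq (v^~ x)]. *)
Lemma nsq_ge1 : V \1_(supp mu) -> forall x, supp mu x -> 1 <= nsq (v^~ x).
Proof.
have [_ -> _] := hv => -[c c1] x Dx.
have ev1 y : ev c (v^~ y) = \1_(supp mu) y by rewrite -linear_combE -c1.
have nc : nsq c <= 1.
  rewrite -lee_fin -parseval.
  under eq_integral do rewrite ev1.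
  apply: (@le_trans _ _ (\int[mu]_y (\1_(supp mu) y)%:E)%E).
    apply: ge0_le_integral => //; last 2 first.
    - by apply/measurable_EFinP; exact: measurable_indic (measurable_supp mu).
    - move=> y _; rewrite lee_fin !indicE.
      by case: (_ \in _); rewrite /sqn /=; lra.
    - by move=> y _; rewrite lee_fin sqn_ge0.
    - apply/measurable_EFinP; under eq_fun do rewrite -ev1.
      apply/measurable_sqn/cmeas_ev => i; first exact: cmeas_cst.
      exact: basis_cmeas.
  rewrite integral_indic ?setIT ?probability_le1//; exact: measurable_supp.
have := sqn_ev_le c (v^~ x); rewrite ev1 indicE mem_set//.
rewrite (_ : sqn _ = 1); last by rewrite /sqn /=; ring.
move/le_trans; apply; rewrite -[leRHS]mul1r.
by rewrite ler_wpM2r// nsq_ge0.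
Qed.

Lemma integral_zero_set c : (forall f : E -> R[i], V f -> f <> 0 ->
    mu (supp mu `&` [set x | f x = 0%R]) = 0%E) -> nsq c != 0 ->
  (\int[mu]_(x in [set x | ev c (v^~ x) = 0%R]) (nsq (v^~ x))%:E = 0)%E.
Proof.
move=> ZC c0; pose f := \sum_(i < N) c i *: v i.
have fE x : f x = ev c (v^~ x) by exact: linear_combE.
have Vf : V f by have [_ -> _] := hv; exists c.
have f0 : f <> 0.
  move=> f0; move/eqP : c0; apply; apply: EFin_inj; rewrite -parseval.
  by apply: integral0_eq => x _; rewrite -fE f0 sqn0.
have := ZC f Vf f0.
rewrite (_ : [set x | f x = 0] = [set x | ev c (v^~ x) = 0]); last first.
  by apply/seteqP; split => x /=; rewrite fE.
set A := [set x | _] => A0.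
have mD := measurable_supp mu.
have mA : measurable A.
  rewrite (_ : A = (fun x => sqn (ev c (v^~ x))) @^-1` [set 0]).
    rewrite -[X in measurable X]setTI; apply: measurable_sqn => //.
    by apply: cmeas_ev => i; [exact: cmeas_cst|exact: basis_cmeas].
  by apply/seteqP; split=> x /= /eqP; rewrite ?sqn_eq0 => /eqP// ->; rewrite sqn0.
(* [A] also contains every point outside the support, but the integrand vanishes there. *)
transitivity (\int[mu]_(x in A `&` supp mu) (nsq (v^~ x))%:E)%E.
  rewrite [RHS]integral_mkcondr; apply: eq_integral => x _.
  by rewrite patchE; case: ifPn => // /negP; rewrite inE => /nsq_off ->.
apply: null_set_integral => //.
- exact: measurableI.
- by apply/measurable_EFinP/measurable_funTS/measurable_nsq; exact: basis_cmeas.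
- by rewrite setIC.
Qed.

Lemma integral_off_supp :
  (\int[mu]_(x in ~` supp mu) (nsq (v^~ x))%:E = 0)%E.
Proof. by apply: integral0_eq => x Dx; rewrite nsq_off. Qed.

End orthonormal.

(** * Size of the mesh *)

Section mesh_size.
Context {R : realType}.
Implicit Type n : nat.

Lemma ln_nat_ge0 n : 0 <= ln (n%:R : R).
Proof. by case: n => [|n]; [rewrite ln0|rewrite ln_ge0// ler1n]. Qed.

Lemma mesh_size_gt0 n : (0 < mesh_size R n)%N.
Proof. by rewrite /mesh_size leq_max. Qed.

Let absz_ceil (x : R) : 0 <= x -> `|Num.ceil x|%N%:R = (Num.ceil x)%:~R :> R.
Proof.
move=> x0; have c0 : 0 <= Num.ceil x.
  by rewrite ceil_ge0 (lt_le_trans _ x0)// ltrN10.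
by rewrite -[in RHS](gez0_abs c0).
Qed.

Lemma mesh_size_ge n : 25 * n%:R * ln n%:R <= (mesh_size R n)%:R :> R.
Proof.
have x0 : 0 <= 25 * n%:R * ln (n%:R : R) by rewrite !mulr_ge0// ln_nat_ge0.
rewrite (le_trans (ceil_ge _))// -absz_ceil// ler_nat.
exact: leq_maxr.
Qed.

Lemma mesh_size_le n : (mesh_size R n)%:R <= 25 * n%:R * ln n%:R + 2 :> R.
Proof.
have x0 : 0 <= 25 * n%:R * ln (n%:R : R) by rewrite !mulr_ge0// ln_nat_ge0.
have : (mesh_size R n)%:R <=
    1 + `|Num.ceil (25 * n%:R * ln (n%:R : R))|%N%:R :> R.
  by rewrite nat1r ler_nat geq_max ltnS leq0n leqnSn.
rewrite absz_ceil//; have := ceilB1_lt (25 * n%:R * ln (n%:R : R)).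
by rewrite rmorphB/=; lra.
Qed.

Lemma mesh_size_ge_dim n : (n <= mesh_size R n)%N.
Proof.
case: n => [//|[|n]]; first exact: mesh_size_gt0.
rewrite -(ler_nat R) (le_trans _ (mesh_size_ge _))//.
have x2 : 2 <= n.+2%:R :> R by rewrite ler_nat.
move: n.+2%:R x2 => x x2.
(* This gives [ln x >= 1 - 1/x >= 1/2] for [x >= 2], so that [25 x ln x >= x]. *)
have : ln (1 + (x^-1 - 1)) <= x^-1 - 1.
  by apply: le_ln1Dx; rewrite ltrBrDl subrr invr_gt0; lra.
rewrite addrC subrK lnV ?posrE; last by lra.
have xV : x^-1 <= 2^-1 by rewrite lef_pV2 ?posrE//; lra.
move=> lnx; have {lnx xV} l2 : 2^-1 <= ln x by lra.
rewrite mulrAC ler_peMl//; first by lra.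
by apply: (le_trans _ (ler_wpM2l _ l2)); lra.
Qed.

Lemma mesh_size_le_powR n (tau : R) : (0 < n)%N -> 0 < tau ->
  (mesh_size R n)%:R <= (25 / tau + 2) * n%:R `^ (1 + tau).
Proof.
move=> n0 tau0; have nR : 0 < n%:R :> R by rewrite ltr0n.
have n1 : 1 <= n%:R :> R by rewrite ler1n.
apply: (le_trans (mesh_size_le n)); rewrite [leRHS]mulrDl lerD//; last first.
  rewrite ler_peMr//; have tau1 : 0 <= 1 + tau by lra.
  by have := ler_powR n1 tau1; rewrite powRr0.
rewrite powRD; last by rewrite (gt_eqF nR) implybT.
rewrite powRr1; last exact: ltW.
have -> : 25 / tau * (n%:R * n%:R `^ tau) = 25 * n%:R * (n%:R `^ tau / tau).
  by ring.
rewrite ler_wpM2l ?mulr_ge0// ler_pdivlMr// mulrC -ln_powR.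
exact/ltW/ln_sublinear/powR_gt0.
Qed.

(* (1 - 1/n)^m <= exp (- m / n) <= n^-25 *)
Lemma failure_probability_le (k n : nat) : (k < n)%N ->
  4 * n%:R * (1 - n%:R^-1) ^+ mesh_size R n <=
  8 * (k.+1%:R^-1 - k.+2%:R^-1) :> R.
Proof.
move=> kn; set x : R := n%:R; set m := mesh_size R n.
have x1 : 1 <= x by rewrite ler1n; exact: leq_trans kn.
have x0 : 0 < x by lra.
have xV1 : x^-1 <= 1 by rewrite invf_le1.
have := mesh_size_ge n; rewrite -/x -/m; clearbody m => mx.
have pm : (1 - x^-1) ^+ m <= x^-1 ^+ 25.
  apply: (@le_trans _ _ (expR (- x^-1) ^+ m)).
    by rewrite lerXn2r ?nnegrE ?expR_ge0 ?expR_ge1Dx//; lra.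
  rewrite -expRM_natl -[in leRHS](lnK x0) -expRN -expRM_natl ler_expR.
  by rewrite !mulrN lerN2 ler_pdivlMr// mulrAC.
have {pm mx} xm : x * (1 - x^-1) ^+ m <= x^-1 ^+ 2.
  apply: (le_trans (ler_wpM2l (ltW x0) pm)).
  rewrite [_ ^+ 25]exprS mulrA divff ?gt_eqF// mul1r.
  by rewrite ler_wiXn2l// invr_ge0 ltW.
have yx : k.+1%:R <= x by rewrite ler_nat.
have : 1 <= k.+1%:R :> R by rewrite ler1n.
rewrite -[k.+2%:R]natr1; move: k.+1%:R yx => y yx y1.
have y0 : 0 < y by exact: lt_le_trans y1.
have xy : x^-1 <= y^-1 by rewrite lef_pV2 ?posrE.
(* With [y = k + 1 <= x], the telescoping difference is at least half of [y^-2], hence of [x^-2]. *)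
have : y^-1 - (y + 1)^-1 = y^-1 ^+ 2 * (y / (y + 1)).
  by field; rewrite !gt_eqF//; lra.
have : 2^-1 <= y / (y + 1) by rewrite ler_pdivlMr; lra.
have : x^-1 ^+ 2 <= y^-1 ^+ 2 by rewrite lerXn2r ?nnegrE ?invr_ge0// ltW.
move: xm; rewrite -mulrA => xm xy2 yy ->.
have : 2^-1 * y^-1 ^+ 2 <= y^-1 ^+ 2 * (y / (y + 1)).
  by rewrite mulrC ler_wpM2l// sqr_ge0.
move: (x * _) (x^-1 ^+ 2) (y^-1 ^+ 2) (_ * (y / _)) xm xy2 => p q r s.
by clear; lra.
Qed.

End mesh_size.

(** * Quantitative injectivity of evaluation maps *)

Section injective_bound.
Context {R : realType} {N : nat}.

(** Injectivity makes the evaluation matrix invertible on one side; [C] is the squared Frobenius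
    norm of the inverse [pinvmx A]. *)
Lemma ev_injective_bound (M : nat) (w : nat -> 'I_N -> R[i]) :
  (forall c, (forall l, (l < M)%N -> ev c (w l) = 0) -> forall i, c i = 0) ->
  exists2 C : R, 0 <= C & forall c, nsq c <= C * \sum_(l < M) sqn (ev c (w l)).
Proof.
move=> inj; pose A : 'M[R[i]]_(N, M) := \matrix_(i, l) w l i.
have evA (u : 'rV_N) l : (u *m A) 0 l = ev (fun i => u 0 i) (w l).
  by rewrite mxE; apply: eq_bigr => i _; rewrite mxE.
have freeA : row_free A.
  rewrite -kermx_eq0; apply/rowV0P => u /sub_kermxP uA.
  apply/rowP => i; rewrite mxE; apply: (inj (fun i => u 0 i)) => l lM.
  by rewrite -(evA u (Ordinal lM)) uA mxE.
exists (\sum_i nsq (fun l => pinvmx A l i)).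
  by apply: sumr_ge0 => i _; exact: nsq_ge0.
move=> c; pose u : 'rV_N := \row_i c i.
have uE : (fun i => u 0 i) = c by apply/funext => i; rewrite mxE.
have cE i : c i = ev (fun l : 'I_M => ev c (w l)) (fun l => pinvmx A l i).
  rewrite -uE -[in LHS](mulmx1 u) -(mulmxVp freeA) mulmxA mxE.
  by apply: eq_bigr => l _; rewrite evA.
rewrite mulr_suml [leLHS](_ : _ = \sum_i sqn (ev (fun l : 'I_M => ev c (w l))
    (fun l => pinvmx A l i))); last by apply: eq_bigr => i _; rewrite -cE.
by apply: ler_sum => i _; rewrite mulrC; exact: sqn_ev_le.
Qed.

End injective_bound.

(** * Weakly admissible meshes *)

Section nat_family.
Context {T : Type} {M : nat}.

(** From index [M] on the member 0 is repeated, so independence is only claimed for indices below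
    [M]. *)
Definition nat_family (M0 : (0 < M)%N) (X : 'I_M -> T) (k : nat) : T :=
  X (insubd (Ordinal M0) k).

Lemma nat_family_ord (M0 : (0 < M)%N) (X : 'I_M -> T) (i : 'I_M) :
  nat_family M0 X i = X i.
Proof. by rewrite /nat_family valKd. Qed.

End nat_family.

Lemma mutually_independent_initial {R : realType} {dO dE : measure_display}
    {Omega : measurableType dO} {E : measurableType dE}
    (P : probability Omega R) (M : nat) (M0 : (0 < M)%N)
    (X : 'I_M -> {RV P >-> E}) :
  mutually_independent P (fun m => X m) ->
  forall k (B : nat -> set E), (k <= M)%N -> (forall i, measurable (B i)) ->
  P [set t | forall i, (i < k)%N -> B i (nat_family M0 X i t)] =
  (\prod_(i < k) P (nat_family M0 X i @^-1` B i))%E.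
Proof.
move=> indep k B kM mB.
have := indep [set i : 'I_M | (i < k)%N]%SET (fun i => B i) (fun i => mB i).
rewrite (_ : \bigcap_(i in _) _ =
    [set t | forall i, (i < k)%N -> B i (nat_family M0 X i t)]); last first.
  apply/seteqP; split => [t tB l lk|t tB i].
    pose j := Ordinal (leq_trans lk kM).
    rewrite -[l]/(val j) nat_family_ord; apply: (tB j) => /=.
    by rewrite inE.
  by rewrite /= inE => ik; rewrite -(nat_family_ord M0 X); exact: tB.
move=> ->.
under eq_bigl do rewrite inE.
rewrite (big_ord_narrow kM); apply: eq_bigr => i _.
by rewrite -(nat_family_ord M0 X).
Qed.

Section deterministic.
Context {R : realType} {E : choiceType}.
Implicit Types (V : set (E -> R[i])) (D A : set E).

(** An arbitrary bound [B] stands for the maximum over the mesh. *)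
Definition controls V D A (C : R) : Prop :=
  forall f B, V f -> (forall a, A a -> cabs (f a) <= B) ->
  forall x, D x -> cabs (f x) <= C * B.

Lemma controls_weaken V D A (C C' : R) : A !=set0 -> C <= C' ->
  controls V D A C -> controls V D A C'.
Proof.
move=> [a Aa] CC' ctl f B Vf fB x Dx; apply: (le_trans (ctl f B Vf fB x Dx)).
by rewrite ler_wpM2r// (le_trans _ (fB a Aa))// cabs_ge0.
Qed.

(** Cauchy-Schwarz at [x] bounds the squared value by [nsq c * K], and the frame bound gives
    [nsq c <= L * M * B^2]. *)
Lemma controls_coef N (v : 'I_N -> E -> R[i]) D (M : nat) (y : nat -> E)
    (L K : R) : (0 < M)%N -> 0 <= L ->
  (forall c, nsq c <= L * \sum_(l < M) sqn (ev c (v^~ (y l)))) ->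
  (forall x, D x -> nsq (v^~ x) <= K) -> 0 <= K ->
  controls [set f | exists c, f = fun x => ev c (v^~ x)] D (y @` `I_M)
    (Num.sqrt (L * M%:R * K)).
Proof.
move=> M0 L0 cL vK K0 f B [c ->] fB x Dx.
have B0 : 0 <= B by rewrite (le_trans _ (fB (y 0%N) _)) ?cabs_ge0//; exists 0%N.
rewrite -(@ler_pXn2r _ 2%N)// ?nnegrE ?cabs_ge0 ?mulr_ge0 ?sqrtr_ge0//.
rewrite exprMn sqr_sqrtr ?mulr_ge0// cabs_sqr.
apply: (le_trans (sqn_ev_le _ _)).
rewrite mulrAC; apply: ler_pM; rewrite ?nsq_ge0 ?vK//.
apply: (le_trans (cL c)); rewrite -mulrA ler_wpM2l//.
have -> : M%:R * B ^+ 2 = \sum_(l < M) B ^+ 2.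
  by rewrite sumr_const card_ord mulr_natl.
apply: ler_sum => l _; rewrite -cabs_sqr lerXn2r ?nnegrE ?cabs_ge0//.
by apply: fB; exists l => /=.
Qed.

End deterministic.

Lemma WAM_of_controls {R : realType} {d : nat} (D : set (borelRn R d)) V
    (N : nat -> nat) (a b ka kb : R) (A : nat -> set (borelRn R d))
    (M : nat -> nat) :
  (forall n, exists y : nat -> borelRn R d, A n = y @` `I_(M n)) ->
  (forall n, A n `<=` D) ->
  (forall n, controls (V n) D (A n) (kb * (N n)%:R `^ b)) ->
  (forall n, (M n)%:R <= ka * (N n)%:R `^ a) ->
  WAM D V N a b A.
Proof.
move=> Ay AD ctl kaM; have finA n : finite_set (A n).
  by have [y ->] := Ay n; exact: finite_image.
split; first by move=> n; split.
exists ka, kb => n; split=> [f Vf|].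
  apply: ge_ereal_sup => _ [x Dx <-]; rewrite lee_fin.
  apply: (ctl n f _ Vf _ x Dx) => z Az.
  apply: (le_bigmax_seq 0 z xpredT (fun x => cabs (f x))) => //.
  by rewrite in_fset_set//; exact: mem_set.
(* Samples may coincide, so [M n] only bounds the cardinality from above. *)
apply: le_trans (kaM n); rewrite ler_nat.
apply: geq_card_fset_set; have [y ->] := Ay n; exact: card_image_le.
Qed.

Section mesh.
Context {R : realType} {d : nat}.
Local Notation E := (borelRn R d).
Variables (mu : probability E R) (V : set (E -> R[i])) (N : nat).
Variable v : 'I_N -> E -> R[i].
Hypotheses (N0 : (0 < N)%N) (hv : orthonormal_basis mu V v).
Hypotheses (hK : (Ksup mu v < +oo)%E) (V1 : V \1_(supp mu)).

Lemma span_evE : V = [set f | exists c, f = fun x => ev c (v^~ x)].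
Proof.
have [_ -> _] := hv; apply/seteqP; split => f [c ->]; exists c.
  by apply/funext => x; exact: linear_combE.
by apply/esym/funext => x; exact: linear_combE.
Qed.

(** Over an empty support, Parseval's identity would make a unit vector have norm 0. *)
Lemma supp_nonempty : supp mu !=set0.
Proof.
apply/set0P/negP => /eqP D0.
have := congr1 EFin (nsq_unitvec (R := R) (Ordinal N0)).
rewrite -(parseval hv) integral0_eq; last first.
  by move=> x _; rewrite (ev_off hv) ?sqn0// D0.
by case=> /eqP; rewrite eq_sym oner_eq0.
Qed.

Lemma nsq_le_Ksup x : supp mu x -> nsq (v^~ x) <= fine (Ksup mu v).
Proof.
move=> Dx; have xK : ((nsq (v^~ x))%:E <= Ksup mu v)%E.
  by apply: ereal_sup_ubound; exists x; rewrite // KdiagE.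
rewrite -lee_fin fineK// fin_numElt hK andbT.
by rewrite (lt_le_trans _ xK)// ltNyr.
Qed.

Lemma Ksup_ge1 : 1 <= fine (Ksup mu v).
Proof.
have [x Dx] := supp_nonempty.
exact: le_trans (nsq_ge1 hv V1 Dx) (nsq_le_Ksup Dx).
Qed.

Section samples.
Context {dO : measure_display} {Omega : measurableType dO}.
Variables (P : probability Omega R) (M : nat) (X : 'I_M -> {RV P >-> E}).
Hypotheses (M0 : (0 < M)%N) (NM : (N <= M)%N).
Hypothesis hlaw : forall m B, measurable B ->
  P (X m @^-1` B) = induced_measure mu v B.
Hypothesis hindep : mutually_independent P (fun m => X m).
Hypothesis ZC : forall f : E -> R[i], V f -> f <> 0 ->
  mu (supp mu `&` [set x | f x = 0%R]) = 0%E.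

Let Y := nat_family M0 X.

Let lawY k (B : set E) : (k < M)%N -> measurable B ->
  P (Y k @^-1` B) = ((N%:R^-1)%:E * \int[mu]_(x in B) (nsq (v^~ x))%:E)%E.
Proof.
move=> kM mB; rewrite hlaw//; congr (_ * _)%E.
by apply: eq_integral => x _; rewrite KdiagE.
Qed.

Lemma range_nat_family t : range (fun m => X m t) = (Y ^~ t) @` `I_M.
Proof.
apply/seteqP; split => [_ [m _ <-]|_ [k kM <-]].
  by exists m => /=; [exact: ltn_ord|rewrite /Y nat_family_ord].
by exists (Ordinal kM); rewrite // -(nat_family_ord M0 X).
Qed.

Lemma samples_in_supp_ae : {ae P, forall t k, (k < M)%N -> supp mu (Y k t)}.
Proof.
have mD := measurable_supp mu.
apply: ae_foralln => k; exists (Y k @^-1` ~` supp mu); split.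
- rewrite -[X in measurable X]setTI.
  by apply: (measurable_funPT (Y k)) => //; exact: measurableC.
- have [kM|Mk] := ltnP k M.
    rewrite [LHS](lawY kM (measurableC mD)).
    by rewrite (integral_off_supp hv) mule0.
  (* Beyond [M] a sample is repeated, and the same law applies. *)
  rewrite [LHS](hlaw _ (measurableC mD)).
  rewrite /induced_measure; under eq_integral do rewrite KdiagE.
  by rewrite (integral_off_supp hv) mule0.
- by move=> t /= /not_implyP[].
Qed.

Lemma samples_injective_ae :
  {ae P, forall t c, (forall l, (l < N)%N -> ev c (v^~ (Y l t)) = 0) ->
    forall i, c i = 0}.
Proof.
apply: (sampling_injective_ae (basis_cmeas hv) (M := M) _ lawY) => //.
- exact: mutually_independent_initial.
- by move=> c c0; exact: (integral_zero_set hv ZC c0).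
Qed.

Lemma measurable_bad_samples : measurable (bad_frame v Y M).
Proof. by apply: measurable_bad_frame; exact: (basis_cmeas hv). Qed.

Lemma probability_bad_samples :
  (P (bad_frame v Y M) <= (4 * N%:R * (1 - N%:R^-1) ^+ M)%:E)%E.
Proof.
apply: (probability_bad_frame (basis_cmeas hv) (parseval hv) _ lawY).
exact: mutually_independent_initial.
Qed.

Lemma good_samples_bound t : ~ bad_frame v Y M t ->
  (forall k, (k < M)%N -> supp mu (Y k t)) ->
  forall c, nsq c <= 4 * \sum_(l < M) sqn (ev c (v^~ (Y l t))).
Proof.
move=> /contrapT good tD c; apply: (le_trans (frame_lower_bound c good)).
rewrite ler_wpM2l//; apply: ler_sum => l _.
have K1 := nsq_ge1 hv V1 (tD l (ltn_ord l)).
by rewrite ler_pdivrMr ?(lt_le_trans ltr01)// ler_peMr// sqn_ge0.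
Qed.

End samples.
End mesh.

(** * Upper limits and the Borel-Cantelli lemma *)

Lemma limn_esup_ge0 {R : realType} (u : nat -> R) :
  (forall n, 0 <= u n) -> (0 <= limn_esup (EFin \o u))%E.
Proof.
move=> u0; apply: limf_esup_ge0 => [[n _ /(_ n (leqnn n))]|n]; rewrite //=.
by rewrite lee_fin.
Qed.

(** The upper limit is an infimum of suprema over tails, and nonnegativity of [u] makes it
    finite. *)
Lemma limn_esup_eventually_le {R : realType} (u : nat -> R) :
  (forall n, 0 <= u n) -> (limn_esup (EFin \o u) < +oo)%E ->
  forall e, 0 < e -> exists n0, forall n, (n0 <= n)%N ->
    u n <= fine (limn_esup (EFin \o u)) + e.
Proof.
move=> u0 uoo e e0.
have l0 := limn_esup_ge0 u0.
have lfin : limn_esup (EFin \o u) \is a fin_num.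
  by rewrite fin_numElt uoo andbT (lt_le_trans _ l0)// ltNyr.
have : (limn_esup (EFin \o u) < (fine (limn_esup (EFin \o u)) + e)%:E)%E.
  by rewrite -[X in (X < _)%E](fineK lfin) lte_fin ltrDl.
move/ereal_inf_lt => [_ [A [n0 _ n0A] <-] Ae].
exists n0 => n n0n; rewrite -lee_fin; apply: le_trans (ltW Ae).
by apply: ereal_sup_ubound; exists n => //; exact: n0A.
Qed.

Lemma Borel_Cantelli_eventually {R : realType} {dO : measure_display}
    {Omega : measurableType dO} (P : probability Omega R)
    (B : nat -> set Omega) (r : nat -> R) (C : R) :
  (forall n, measurable (B n)) -> (forall n, (P (B n) <= (r n)%:E)%E) ->
  (forall n, \sum_(i < n) r i <= C) ->
  {ae P, forall t, exists n0, forall n, (n0 <= n)%N -> ~ B n t}.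
Proof.
move=> mB PB rC; exists (lim_sup_set B); split.
- apply: bigcap_measurable => [|k _]; first by exists 0%N.
  by apply: bigcup_measurable.
- apply: lim_sup_set_cvg0 => //; apply: (@le_lt_trans _ _ C%:E); last exact: ltry.
  apply: lime_le.
    by apply: is_cvg_nneseries => n _ _; exact: measure_ge0.
  apply: nearW => n; rewrite big_mkord.
  apply: (@le_trans _ _ (\sum_(i < n) (r i)%:E)%E).
    by apply: lee_sum => i _; exact: PB.
  by rewrite sumEFin lee_fin.
- move=> t /= /forallNP tB n _.
  have /existsNP[k /not_implyP[nk /contrapT Bk]] := tB n.
  by exists k.
Qed.

(** * Almost sure admissibility of the random meshes *)

Theorem corollary4p3 (R : realType) (d : nat)
  (mu : probability (borelRn R d) R)
  (V : nat -> set (borelRn R d -> R[i])) (N : nat -> nat)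
  (v : forall n : nat, 'I_(N n) -> borelRn R d -> R[i])
  (hN : forall n : nat, (1 <= N n)%N)
  (hv : forall n : nat, orthonormal_basis mu (V n) (v n))
  (hVincl : forall n : nat, V n `<=` V n.+1)
  (hVdim : forall n : nat, (N n < N n.+1)%N)
  (hK : forall n : nat, (Ksup mu (v n) < +oo)%E)
  (hq : (qstar mu v < +oo)%E)
  (h1 : V 0%N (\1_(supp mu)))
  (hZC : muZC mu V)
  (dO : measure_display) (Omega : measurableType dO)
  (P : probability Omega R)
  (X : forall n : nat, 'I_(mesh_size R (N n)) -> {RV P >-> borelRn R d})
  (hlaw : forall (n : nat) (m : 'I_(mesh_size R (N n))) (B : set (borelRn R d)),
     measurable B -> P (X n m @^-1` B) = induced_measure mu (v n) B)
  (hindep : forall n : nat, mutually_independent P (fun m => X n m)) :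
  {ae P, forall omega : Omega, forall tau : R, 0 < tau ->
    WAM (supp mu) V N (1 + tau) ((fine (qstar mu v) + 1) / 2 + tau)
      (fun n => range (fun m => X n m omega))}.
Proof.
have V1 n : V n \1_(supp mu) by elim: n => [//|n IH]; exact/hVincl/IH.
have ltnN n : (n < N n)%N.
  by elim: n => [|n IH]; [exact: hN|exact: leq_ltn_trans IH (hVdim n)].
pose M n := mesh_size R (N n).
have M0 n : (0 < M n)%N := mesh_size_gt0 (N n).
have NM n : (N n <= M n)%N := mesh_size_ge_dim (N n).
pose Y n := nat_family (M0 n) (X n).
pose K n := fine (Ksup mu (v n)).
have K1 n : 1 <= K n := Ksup_ge1 (hN n) (hv n) (hK n) (V1 n).
have K0 n : 0 <= K n := le_trans ler01 (K1 n).
pose bad n := bad_frame (v n) (Y n) (M n).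
have aeD : {ae P, forall t n k, (k < M n)%N -> supp mu (Y n k t)}.
  by apply: ae_foralln => n; exact: (samples_in_supp_ae (hv n) (M0 n) (hlaw n)).
have aeI : {ae P, forall t n c, (forall l, (l < N n)%N ->
    ev c ((v n)^~ (Y n l t)) = 0) -> forall i, c i = 0}.
  apply: ae_foralln => n.
  exact: (samples_injective_ae (hv n) (M0 n) (NM n) (hlaw n) (hindep n) (hZC n)).
(* As [n < N n], the failure probabilities are dominated by a telescoping series with partial sums
   at most 8. *)
have aeB : {ae P, forall t, exists n0, forall n, (n0 <= n)%N -> ~ bad n t}.
  apply: (@Borel_Cantelli_eventually _ _ _ P bad
      (fun n => 8 * (n.+1%:R^-1 - n.+2%:R^-1)) 8).
  - by move=> n; exact: (measurable_bad_samples (hv n) (X n) (M0 n)).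
  - move=> n.
    have := probability_bad_samples (hv n) (M0 n) (hlaw n) (hindep n).
    by move=> /le_trans; apply; rewrite lee_fin failure_probability_le.
  - move=> n; rewrite -mulr_sumr.
    have -> : \sum_(i < n) (i.+1%:R^-1 - i.+2%:R^-1) = 1 - n.+1%:R^-1 :> R.
      elim: n => [|n IH]; first by rewrite big_ord0 invr1 subrr.
      by rewrite big_ord_recr/= IH addrA subrK.
    by rewrite ler_piMr// gerBl invr_ge0.
(* The three almost sure events do not involve [tau], so one null set serves every [tau]. The rest
   is deterministic. *)
apply: filterS3 aeD aeI aeB => t tD tI [n0 good] tau tau0.
pose Q := fine (qstar mu v); pose b := (Q + 1) / 2 + tau.
pose A n := range (fun m => X n m t).
pose u n := ln (K n) / ln (N n)%:R.
have u0 n : 0 <= u n by rewrite divr_ge0// ?ln_nat_ge0// ln_ge0.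
have [n1 uQ] := limn_esup_eventually_le u0 hq tau0.
have Q0 : 0 <= Q := fine_ge0 (limn_esup_ge0 u0).
have Npos n : 0 < (N n)%:R :> R by rewrite ltr0n.
(* Taking [n >= 1] ensures [N n >= 2], so that one can multiply by a positive [ln (N n)]. *)
have KQ n : (maxn n1 1 <= n)%N -> K n <= (N n)%:R `^ (Q + tau).
  rewrite geq_max => /andP[n1n n1']; have := uQ n n1n.
  have lnN : 0 < ln (N n)%:R :> R.
    by rewrite ln_gt0// ltr1n (leq_trans _ (ltnN n)).
  rewrite /u ler_pdivrMr// -ln_powR ler_ln ?posrE ?powR_gt0//.
  exact: lt_le_trans (K1 n).
pose ka : R := 25 / tau + 2.
have kaM n : (M n)%:R <= ka * (N n)%:R `^ (1 + tau) by exact: mesh_size_le_powR.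
have /choice[L Lfr] : forall n, exists L : R, [/\ 0 <= L,
    forall c, nsq c <= L * \sum_(l < M n) sqn (ev c ((v n)^~ (Y n l t))) &
    (n0 <= n)%N -> L = 4].
  move=> n; have [n0n|nn0] := leqP n0 n.
    exists 4; split => //.
    exact: (good_samples_bound (hv n) (V1 n) (good n n0n) (tD n)).
  have [|L L0 Lc] :=
    @ev_injective_bound R (N n) (M n) (fun l => (v n)^~ (Y n l t)).
    by move=> c c0; apply: (tI n) => l lN; apply: c0; exact: leq_trans (NM n).
  by exists L; split.
pose C n := Num.sqrt (L n * (M n)%:R * K n).
have ctl n : controls (V n) (supp mu) (A n) (C n).
  have [L0 Lc _] := Lfr n.
  rewrite (span_evE (hv n)) /A (range_nat_family (X n) (M0 n)).
  exact: controls_coef (M0 n) L0 Lc (nsq_le_Ksup (hK n)) (K0 n).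
pose m := maxn n0 (maxn n1 1).
(* The first term serves all [n >= m]; the sum dominates each of the finitely many earlier
   constants. *)
pose kb := 2 * Num.sqrt ka + \sum_(n < m) C n.
have ka0 : 0 <= ka by rewrite addr_ge0// divr_ge0// ltW.
have N1 n : 1 <= (N n)%:R `^ b.
  rewrite -{1}(powRr0 (N n)%:R) ler_powR ?ler1n//.
  by rewrite addr_ge0 ?divr_ge0 ?addr_ge0// ltW.
have CN n : C n <= kb * (N n)%:R `^ b.
  have S0 : 0 <= \sum_(n < m) C n by apply: sumr_ge0 => i _; exact: sqrtr_ge0.
  have [mn|nm] := leqP m n; last first.
    have Ckb : C n <= kb.
      rewrite /kb (bigD1 (Ordinal nm))//= addrCA lerDl.
      rewrite addr_ge0 ?mulr_ge0 ?sqrtr_ge0//.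
      by apply: sumr_ge0 => i _; exact: sqrtr_ge0.
    by rewrite (le_trans Ckb)// ler_peMr// (le_trans _ Ckb)// sqrtr_ge0.
  move: mn; rewrite geq_max => /andP[n0n /KQ KQn].
  have [_ _ /(_ n0n) L4] := Lfr n.
  apply: (@le_trans _ _ (2 * Num.sqrt ka * (N n)%:R `^ b)); last first.
    by rewrite ler_wpM2r ?powR_ge0// lerDl.
  rewrite -(@ler_pXn2r _ 2%N)// ?nnegrE ?mulr_ge0 ?sqrtr_ge0 ?powR_ge0//.
  rewrite sqr_sqrtr L4 ?mulr_ge0// !exprMn sqr_sqrtr//.
  rewrite [(_ `^ b) ^+ 2]expr2 -powRD ?(gt_eqF (Npos n)) ?implybT//.
  (* The value of [b] comes from here: [C n ^+ 2] is [4 * M n * K n], with exponent [1 + tau] from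
     the mesh size and [Q + tau] from [K n]. *)
  have -> : b + b = (1 + tau) + (Q + tau) by rewrite /b; field.
  rewrite powRD ?(gt_eqF (Npos n)) ?implybT// -[2 ^+ 2]natrX.
  rewrite -2!mulrA ler_wpM2l// mulrA.
  by apply: ler_pM.
apply: (@WAM_of_controls R d (supp mu) V N _ _ ka kb A M) => //.
- by move=> n; exists (Y n ^~ t); rewrite /A (range_nat_family (X n) (M0 n)).
- move=> n; rewrite /A (range_nat_family (X n) (M0 n)) => _ [k kM <-].
  exact: tD.
- move=> n; apply: controls_weaken (CN n) (ctl n).
  by exists (X n (Ordinal (M0 n)) t); exists (Ordinal (M0 n)).
Qed.
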